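(* Let $K$ be a field of characteristic $p>0$ with algebraic closure $K^{alg}$, let $n\ge1$ and $\underline f=(f_1,\dots,f_n)\in K^n$ with $\Delta_n(\underline f)\ne0$. Let $V$ be the $\mathbb{F}_p$-vector space $\dfrac{(\sum_{i=1}^n\mathbb{F}_pf_i)+(F-\mathrm{Id})(K)}{(F-\mathrm{Id})(K)}$, of dimension $r\le n$, and let $I\sqcup J$ be a partition of $\{1,\dots,n\}$ such that the $f_i$, $i\in I$, induce an $\mathbb{F}_p$-basis of $V$. Let $A$ be the $K$-algebra $K[W_k,1\le k\le n]/(P_k)_{1\le k\le n}$ where $P_k:=W_k^p-W_k-f_k$. (1) $A$ is an étale $K$-algebra isomorphic to $L^{p^{n-r}}$, the cartesian product of $p^{n-r}$ copies of $L$, where $L\subset K^{alg}$ is a field which is a Galois extension of $K$ with group $(\mathbb{Z}/p\mathbb{Z})^r$, and $L\simeq K[W_k,k\in I]/(P_k)_{k\in I}$. (2) The group $\operatorname{Aut}_KA$ of $K$-algebra automorphisms of $A$ is isomorphic to a semidirect product of the groups $\mathfrak{S}_{p^{n-r}}$ and $((\mathbb{Z}/p\mathbb{Z})^r)^{p^{n-r}}$. (3) Let $w_i$ be the canonical image of $W_i$ in $A$ and let $$w:=\begin{vmatrix}w_1&w_2&\cdots&w_n\\ f_1&f_2&\cdots&f_n\\ f_1^p&f_2^p&\cdots&f_n^p\\ \vdots&\vdots&\cdots&\vdots\\ f_1^{p^{n-2}}&f_2^{p^{n-2}}&\cdots&f_n^{p^{n-2}}\end{vmatrix}\in K[w_1,\dots,w_n].$$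 Put $d_i:=(-1)^{i-1}\Delta_{n-1}(\underline{\hat f_i})$. Then for $1\le i\le n$ $$w_i=\frac{\Delta_n(d_1,\dots,d_{i-1},w,d_{i+1},\dots,d_n)}{\Delta_n(d_1,\dots,d_n)}-(f_i+f_i^p+\cdots+f_i^{p^{n-2}})\in K[w],$$ and $$A=K[w_1,\dots,w_n]=K[w]\simeq K[W]/(Q(W)),\qquad Q(w)=0,$$ where $$Q(W)=\frac{\Delta_{n+1}(\Delta_{n-1}(\underline{\hat f_1}),\dots,\Delta_{n-1}(\underline{\hat f_n}),W)}{\Delta_n(\Delta_{n-1}(\underline{\hat f_1}),\dots,\Delta_{n-1}(\underline{\hat f_n}))}-\Delta_n(\underline f)^{p^{n-1}}$$ $$=W^{p^n}+\Big(\sum_{i=1}^{n-1}(-1)^{n-i}\Delta_n(\underline f)^{p^{n-1}-p^{i-1}-p^i}\,\big(\Delta[n-i](\underline f)\big)^{p^{i-1}}W^{p^i}\Big)+(-1)^n\Delta_n(\underline f)^{p^{n-1}-1}W-\Delta_n(\underline f)^{p^{n-1}}.$$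
   Context: Here $q=p$. $F$ is the Frobenius $F(x)=x^p$. For $\underline a=(a_1,\dots,a_n)$ in a commutative ring containing $\mathbb{F}_p$, $\Delta_n(\underline a):=\det\big(a_j^{p^{i-1}}\big)_{1\le i,j\le n}$ is the Moore determinant, with $\Delta_0:=1$; for $\underline a\in K^n$, $\Delta_n(\underline a)\ne0$ iff the $a_i$ are $\mathbb{F}_p$-linearly independent. $\underline{\hat f_i}:=(f_1,\dots,f_{i-1},f_{i+1},\dots,f_n)$. For $0\le i\le n$, $\Delta[i](\underline f)$ is the determinant of the $n\times n$ matrix with rows $\underline f,F(\underline f),\dots,F^n(\underline f)$ with the row $F^i(\underline f)$ omitted, where $F^k(\underline f)=(f_1^{p^k},\dots,f_n^{p^k})$. For $n=1$, the sums $f_i+\cdots+f_i^{p^{n-2}}$ and $\sum_{i=1}^{n-1}$ are empty and $w=w_1$. *)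

(* Defs.v *)
From HB Require Import structures.
From mathcomp Require Import all_boot all_order all_algebra.
From mathcomp Require Import all_fingroup all_solvable all_field.
From mathcomp Require Import generic_quotient ring_quotient qpoly.
From mathcomp Require Import boolp.
From mathcomp Require Import mpoly.

Set Implicit Arguments.
Unset Strict Implicit.
Unset Printing Implicit Defensive.

Import GRing.Theory.
Local Open Scope ring_scope.
Local Open Scope quotient_scope.

Definition moore (R : comNzRingType) (p n : nat) (a : 'I_n -> R) : R :=
  \det (\matrix_(i < n, j < n) a j ^+ (p ^ i)).

(* Delta[i]: [bump i] enumerates the Frobenius powers 0, ..., n without i. *)
Definition moore_omit (R : comNzRingType) (p n : nat) (i : nat)
    (a : 'I_n -> R) : R :=
  \det (\matrix_(k < n, j < n) a j ^+ (p ^ bump i k)).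

Definition hat (T : Type) (n : nat) (f : 'I_n -> T) (i : 'I_n) : 'I_n.-1 -> T :=
  fun k => f (lift i k).

Section Ideal.
Variables (R : comNzRingType) (m : nat) (P : 'I_m -> R).

Definition in_gen_ideal (x : R) : Prop :=
  exists c : 'I_m -> R, x = \sum_(k < m) c k * P k.

End Ideal.

(* [AScoker] is K / (F - Id)(K). The unused argument [pK] of [ASimage] lets the
   subgroup instance, which needs characteristic p, be found by inference. *)
Section Cokernel.
Variables (K : fieldType) (p : nat).

Definition ASimage (pK : p \in [pchar K]) : {pred K} :=
  fun x => `[< exists y : K, x = y ^+ p - y >].

Variable pK : p \in [pchar K].

Fact ASimage_zmod_closed : zmod_closed (ASimage pK).
Proof.
split; first by apply/asboolP; exists 0; rewrite expr0n subr0
  (gtn_eqF (prime_gt0 (pcharf_prime pK))).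
move=> x y /asboolP[a ->] /asboolP[b ->]; apply/asboolP; exists (a - b).
have := pFrobenius_autB_comm pK (mulrC a b); rewrite !pFrobenius_autE => ->.
by rewrite !opprD !opprK addrACA.
Qed.

HB.instance Definition _ :=
  GRing.isZmodClosed.Build K (ASimage pK) ASimage_zmod_closed.

Definition AScoker : zmodType := {ideal_quot (ASimage pK)}.

Definition AScls (x : K) : AScoker := \pi_({ideal_quot (ASimage pK)}) x.

(* The subspace ((sum_i F_p f_i) + (F - Id)(K)) / (F - Id)(K); a scalar c of
   'F_p acts as the natural multiple [_ *+ c], K being of characteristic p. *)
Definition ASspace (n : nat) (f : 'I_n -> K) (v : AScoker) : Prop :=
  exists (c : 'I_n -> 'F_p) (y : K),
    v = AScls (\sum_(i < n) f i *+ c i + (y ^+ p - y)).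

Definition ASbasis (n : nat) (f : 'I_n -> K) (m : nat) (v : 'I_m -> AScoker)
    : Prop :=
  [/\ forall k, ASspace f (v k),
      forall c : 'I_m -> 'F_p, \sum_(k < m) v k *+ c k = 0 ->
        forall k, c k = 0
    & forall x, ASspace f x ->
        exists c : 'I_m -> 'F_p, x = \sum_(k < m) v k *+ c k].

Definition ASdim (n : nat) (f : 'I_n -> K) (r : nat) : Prop :=
  exists v : 'I_r -> AScoker, ASbasis f v.

End Cokernel.

(* A ring in which all the equations x_k ^ p - x_k = g_k have a solution; it
   shows that the ideal (P_k) is proper. *)
Lemma AS_solvable (p m : nat) (R : comNzRingType) (g : 'I_m -> R) : (1 < p)%N ->
  exists (S : comNzRingType) (h : {rmorphism R -> S}) (x : 'I_m -> S),
    forall k, x k ^+ p - x k - h (g k) = 0.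
Proof.
move=> p1; elim: m g => [|m IHm] g; first by exists R, idfun, (fun _ => 0); case.
have [S [h [x hx]]] := IHm (fun k => g (lift ord0 k)).
pose c := h (g ord0); pose P : {poly S} := 'X^p - ('X + c%:P).
have sXC : (size ('X + c%:P)%R < p.+1)%N by rewrite size_XaddC ltnS.
have sP : size P = p.+1 by rewrite /P size_polyDl ?size_polyN size_polyXn.
have mP : P \is monic.
  by rewrite monicE lead_coefDl ?size_polyN ?size_polyXn // lead_coefXn.
have mkP : mk_monic P = P by rewrite /mk_monic sP mP ltnS (ltnW p1).
pose j : {rmorphism {poly S} -> {poly %/ P}} := in_qpoly P.
have jP : j P = 0.
  apply/val_inj; rewrite /= mkP.
  exact: (Pdiv.RingMonic.rmodpp mP).
exists {poly %/ P}, (j \o (polyC \o h)).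
exists (fun k => if unlift ord0 k is Some l then j (x l)%:P else j 'X) => k.
case: unliftP => [l ->|->] /=.
  by rewrite -rmorphXn -!rmorphB -polyC_exp -!polyCB hx /= rmorph0.
by rewrite -rmorphXn -!rmorphB -addrA -opprD.
Qed.

(* The K-algebra K[W_k, k < m] / (W_k ^ p - W_k - g_k). *)
Section ArtinSchreierAlgebra.
Variables (K : fieldType) (p : nat) (m : nat).

Definition ASpoly (g : 'I_m -> K) (k : 'I_m) : {mpoly K[m]} :=
  'X_k ^+ p - 'X_k - (g k)%:MP.

Definition ASideal (pK : p \in [pchar K]) (g : 'I_m -> K) :
    {pred {mpoly K[m]}} :=
  fun q => `[< in_gen_ideal (ASpoly g) q >].

Variables (pK : p \in [pchar K]) (g : 'I_m -> K).

Fact ASideal_closed : idealr_closed (ASideal pK g).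
Proof.
split.
- by apply/asboolP; exists (fun _ => 0); rewrite big1 // => k _; rewrite mul0r.
- apply/negP=> /asboolP[c c1].
  have [S [h [x hx]]] := AS_solvable g (prime_gt1 (pcharf_prime pK)).
  have := congr1 (mmap h x) c1.
  rewrite rmorph1 rmorph_sum big1 => [/eqP|k _]; first by rewrite oner_eq0.
  by rewrite rmorphM !rmorphB rmorphXn /= mmapX mmap1U mmapC hx mulr0.
- move=> a u v /asboolP[c ->] /asboolP[d ->]; apply/asboolP.
  exists (fun k => a * c k + d k); rewrite mulr_sumr -big_split.
  by apply: eq_bigr => k _; rewrite mulrDl mulrA.
Qed.

HB.instance Definition _ :=
  isIdealr.Build {mpoly K[m]} (ASideal pK g) ASideal_closed.

Definition ASalg : Type := {ideal_quot (ASideal pK g)}.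
HB.instance Definition _ := GRing.ComNzRing.on ASalg.

Definition ASpi : {mpoly K[m]} -> ASalg :=
  fun q => \pi_({ideal_quot (ASideal pK g)}) q.
HB.instance Definition _ := GRing.RMorphism.copy ASpi
  (\pi_({ideal_quot (ASideal pK g)}) : {mpoly K[m]} -> _).

Definition ASscale (a : K) (x : ASalg) : ASalg := ASpi a%:MP * x.

Fact ASscaleA a b x : ASscale a (ASscale b x) = ASscale (a * b) x.
Proof. by rewrite /ASscale mulrA -rmorphM /= -mpolyCM. Qed.
Fact ASscale1 : left_id 1 ASscale.
Proof. by move=> x; rewrite /ASscale !rmorph1 mul1r. Qed.
Fact ASscaleDr : right_distributive ASscale +%R.
Proof. by move=> a x y; rewrite /ASscale mulrDr. Qed.
Fact ASscaleDl x : {morph ASscale^~ x : a b / a + b}.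
Proof. by move=> a b; rewrite /ASscale !rmorphD mulrDl. Qed.
HB.instance Definition _ := GRing.Zmodule_isLmodule.Build K ASalg
  ASscaleA ASscale1 ASscaleDr ASscaleDl.
Fact ASscaleAl (a : K) (x y : ASalg) : a *: (x * y) = (a *: x) * y.
Proof. exact: mulrA. Qed.
HB.instance Definition _ := GRing.Lmodule_isLalgebra.Build K ASalg ASscaleAl.
HB.instance Definition _ := GRing.Lalgebra_isComAlgebra.Build K ASalg.

Definition ASvar (k : 'I_m) : ASalg := ASpi 'X_k.

End ArtinSchreierAlgebra.

Section Algebras.
Variable K : fieldType.

Definition finitely_presented (A : comAlgType K) : Prop :=
  exists (m : nat) (h : {lrmorphism {mpoly K[m]} -> A}),
    (forall a, exists q, h q = a) /\
    exists (s : nat) (P : 'I_s -> {mpoly K[m]}),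
      forall q, h q = 0 <-> in_gen_ideal P q.

(* The infinitesimal lifting criterion. Restricting to non-zero rings B and C
   loses nothing: a ring with a square-zero ideal and zero quotient is zero. *)
Definition formally_etale (A : comAlgType K) : Prop :=
  forall (B C : comAlgType K) (h : {lrmorphism B -> C}),
    (forall c, exists b, h b = c) ->
    (forall x y, h x = 0 -> h y = 0 -> x * y = 0) ->
    forall u : {lrmorphism A -> C},
      exists v : {lrmorphism A -> B},
        h \o v =1 u /\
        forall v' : {lrmorphism A -> B}, h \o v' =1 u -> v' =1 v.

Definition etale (A : comAlgType K) : Prop :=
  finitely_presented A /\ formally_etale A.

(* [Psi] is a group isomorphism from gT onto Aut_K(A) under composition. *)
Definition Aut_isog (A : comAlgType K) (gT : finGroupType) : Prop :=
  exists Psi : gT -> {lrmorphism A -> A},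
    [/\ forall s, bijective (Psi s),
        forall s t, Psi (s * t)%g =1 Psi s \o Psi t,
        forall s t, Psi s =1 Psi t -> s = t
      & forall phi : {lrmorphism A -> A}, bijective phi ->
          exists s, Psi s =1 phi].

End Algebras.

Section Data.
Variables (K : fieldType) (p n : nat) (f : 'I_n -> K).

Definition minor (i : 'I_n) : K := moore p (hat f i).

(* Indices start at 0, so that (-1)^(i-1) becomes (-1)^i. *)
Definition dcoef (i : 'I_n) : K := (-1) ^+ i * minor i.

Definition wdet (A : comAlgType K) (w : 'I_n -> A) : A :=
  \det (\matrix_(i < n, j < n)
    if i == 0 :> nat then w j else (f j ^+ (p ^ i.-1))%:A).

Definition Qpoly : {poly K} :=
  (moore p minor)^-1 *:
    moore p (fun k : 'I_n.+1 =>
      if unlift ord_max k is Some j then (minor j)%:P else 'X)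
  - (moore p f ^+ (p ^ n.-1))%:P.

End Data.

(* Main.v *)
Require Import Defs.
From HB Require Import structures.
From mathcomp Require Import all_boot all_order all_algebra.
From mathcomp Require Import all_fingroup all_solvable all_field.
From mathcomp Require Import generic_quotient ring_quotient qpoly.
From mathcomp Require Import boolp.
From mathcomp Require Import mpoly.
From mathcomp Require Import zify ring.

(* With d_j the signed minors of the Moore matrix M = (f_j^(p^k)), w is
   sum_j d_j w_j. The vector d is orthogonal to the first n - 1 rows of M, so
   the elements x_j = w_j^(p^(n-1)) = w_j + f_j + ... + f_j^(p^(n-2)) satisfy
   sum_j d_j^(p^k) x_j = w^(p^k) for k < n, with a defect Delta^(p^(n-1)) for
   k = n. Cramer's rule recovers w_j from w, and the last equation is Q(w) = 0;
   conversely, a root of Q in any K-algebra gives a solution of the equations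
   W_j^p - W_j = f_j. The coefficients of Q follow from the companion matrix
   C = F(M) M^-1: iterating M^-1 = F(M^-1) C yields an additive polynomial that
   vanishes on the d_j.

   Let L = K(z) for a root z of Q in Kalg; it contains all the roots
   z + sum_j c_j d_j (c in F_p^n) of Q, hence is Galois. An automorphism s is
   determined by the s(alpha_i) - alpha_i in F_p for i in I; if these vectors
   did not span F_p^r, some nonzero combination sum_i c_i alpha_i would be
   fixed, hence in K, contradicting the independence of the f_i modulo
   (F - Id)(K). The points alpha + c, with c supported on J, represent the
   Galois orbits of points of A, and evaluation at them is the isomorphism
   from A to L^(p^(n-r)). A K-automorphism of L^N permutes the primitive
   idempotents, and acts on each factor by an element of the Galois group. *)

Set Implicit Arguments.
Unset Strict Implicit.
Unset Printing Implicit Defensive.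

Import GRing.Theory.
Local Open Scope ring_scope.

(** * Iterates of the Frobenius endomorphism *)

Section FrobeniusPower.
Variables (R : comNzRingType) (p : nat).

(** The proof [pR] is an argument so that the ring morphism structure of [frob pR k] can be found by
    inference. *)
Definition frob (pR : p \in [pchar R]) (k : nat) (x : R) : R := x ^+ (p ^ k).

Variable pR : p \in [pchar R].

Lemma frobS k x : frob pR k.+1 x = frob pR k x ^+ p.
Proof. by rewrite /frob expnSr exprM. Qed.

Lemma frob_comp k l x : frob pR k (frob pR l x) = frob pR (k + l) x.
Proof. by rewrite /frob -exprM -expnD addnC. Qed.

Fact frob_zmod_morphism k : zmod_morphism (frob pR k).
Proof.
elim: k => [|k IHk] x y; first by rewrite /frob !expr1.
rewrite !frobS IHk; have :=
  pFrobenius_autB_comm pR (mulrC (frob pR k x) (frob pR k y)).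
by rewrite !pFrobenius_autE.
Qed.

Fact frob_monoid_morphism k : monoid_morphism (frob pR k).
Proof. by split=> [|x y]; rewrite /frob ?expr1n ?exprMn. Qed.

HB.instance Definition _ k :=
  GRing.isZmodMorphism.Build R R (frob pR k) (frob_zmod_morphism k).
HB.instance Definition _ k :=
  GRing.isMonoidMorphism.Build R R (frob pR k) (frob_monoid_morphism k).

Lemma frobE k x : frob pR k x = x ^+ (p ^ k). Proof. by []. Qed.

End FrobeniusPower.

(** * Expansions of Moore determinants *)

Section Expansions.
Variables (R : comNzRingType) (p : nat).

(** Coordinate [i] of the product of the adjugate of [A] with [A *m x]: a division-free Cramer rule,
    to be used over K-algebras that are not fields. *)
Lemma cramer_cofactor n (A : 'M[R]_n) (x : 'I_n -> R) (i : 'I_n) :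
  \sum_k (\sum_j A k j * x j) * cofactor A k i = \det A * x i.
Proof.
have := congr1 (fun B : 'M_n => (B *m (\col_j x j)) i 0) (mul_adj_mx A).
rewrite mul_scalar_mx !mxE => <-.
under eq_bigr do rewrite mulr_suml.
rewrite exchange_big; apply: eq_bigr => j _.
rewrite !mxE mulr_suml; apply: eq_bigr => k _.
by rewrite !mxE mulrC mulrA.
Qed.

(** The cofactors of column [i] do not see that column, so they are those of the unmodified Moore
    matrix. *)
Lemma moore_set_col n (d : 'I_n -> R) (y : R) (i : 'I_n) :
  moore p (fun k => if k == i then y else d k) =
  \sum_(k < n) y ^+ (p ^ k)
    * cofactor (\matrix_(k < n, j < n) d j ^+ (p ^ k)) k i.
Proof.
rewrite /moore (expand_det_col _ i); apply: eq_bigr => k _.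
rewrite !mxE eqxx /cofactor; congr (_ * (_ * \det _)).
by apply/matrixP=> a b; rewrite !mxE eq_sym (negPf (neq_lift _ _)).
Qed.

Definition snoc n (a : 'I_n -> R) (x : R) : 'I_n.+1 -> R :=
  fun k => if unlift ord_max k is Some j then a j else x.

Lemma moore_snoc n (a : 'I_n -> R) (x : R) :
  moore p (snoc a x) =
  \sum_(k < n.+1) (-1) ^+ (k + n) * moore_omit p k a * x ^+ (p ^ k).
Proof.
rewrite /moore (expand_det_col _ ord_max); apply: eq_bigr => k _.
rewrite !mxE /snoc unlift_none mulrC; congr (_ * _).
rewrite /cofactor /=; congr (_ * \det _).
by apply/matrixP=> i j; rewrite !mxE liftK.
Qed.

Lemma moore_snoc_mem n (a : 'I_n -> R) (i : 'I_n) : moore p (snoc a (a i)) = 0.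
Proof.
rewrite /moore -det_tr.
apply: (@determinant_alternate _ _ _ (lift ord_max i) ord_max).
  by rewrite eq_sym neq_lift.
by move=> j; rewrite !mxE /snoc liftK unlift_none.
Qed.

Lemma moore_omit_max n (a : 'I_n -> R) : moore_omit p n a = moore p a.
Proof.
congr (\det _); apply/matrixP=> i j.
by rewrite !mxE /bump leqNgt ltn_ord.
Qed.

(** Rows 1 to n are the Frobenius twists of rows 0 to n - 1. *)
Lemma moore_omit0 (pR : p \in [pchar R]) n (a : 'I_n -> R) :
  moore_omit p 0 a = frob pR 1 (moore p a).
Proof.
rewrite /moore -det_map_mx; congr (\det _); apply/matrixP=> i j.
by rewrite !mxE /= frobE -exprM -expnD addn1.
Qed.

(** Every [a i] is a root of the additive polynomial obtained by adjoining a variable column to the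
    Moore matrix, since two columns then coincide. *)
Lemma moore_linear_rec n (a : 'I_n -> R) (i : 'I_n) :
  \sum_(k < n.+1) (-1) ^+ (k + n) * moore_omit p k a * a i ^+ (p ^ k) = 0.
Proof. by rewrite -moore_snoc moore_snoc_mem. Qed.

End Expansions.

Lemma moore_rmorph (R S : comNzRingType) p (h : {rmorphism R -> S}) n
    (a : 'I_n -> R) : moore p (h \o a) = h (moore p a).
Proof.
rewrite /moore -det_map_mx; congr (\det _).
by apply/matrixP=> i j; rewrite !mxE rmorphXn.
Qed.

Lemma moore_omit_rmorph (R S : comNzRingType) p (h : {rmorphism R -> S}) n k
    (a : 'I_n -> R) : moore_omit p k (h \o a) = h (moore_omit p k a).
Proof.
rewrite /moore_omit -det_map_mx; congr (\det _).
by apply/matrixP=> i j; rewrite !mxE rmorphXn.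
Qed.

(** * The dual family *)

Section Dual.
Variables (K : fieldType) (p : nat) (pK : p \in [pchar K]).
Variables (m : nat) (f : 'I_m.+1 -> K).

Local Notation F := (frob pK).
Local Notation d := (dcoef p f).
Local Notation Delta := (moore p f).

(** Expansion along the first row, the only one with entries outside K; its minors are the Moore
    determinants of the families [hat f j]. *)
Lemma wdetE (B : comAlgType K) (w : 'I_m.+1 -> B) :
  wdet p f w = \sum_j d j *: w j.
Proof.
rewrite /wdet (expand_det_row _ ord0); apply: eq_bigr => j _.
rewrite !mxE /= mulrC -[RHS]mulr_algl; congr (_ * _).
rewrite -[RHS]/(in_alg B _) /dcoef /minor rmorphM rmorph_sign /= /cofactor /=.
rewrite add0n; congr (_ * _).
rewrite -[RHS]/(in_alg B _) -moore_rmorph; congr (\det _).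
by apply/matrixP=> i k; rewrite !mxE -[LHS]/(in_alg B _) rmorphXn.
Qed.

Definition dualpair (v : 'I_m.+1 -> K) := \sum_j d j * v j.

Lemma dualpairE v : dualpair v =
  \det (\matrix_(i < m.+1, j < m.+1)
    if i == 0 :> nat then v j else f j ^+ (p ^ i.-1)).
Proof.
rewrite (expand_det_row _ ord0); apply: eq_bigr => j _.
rewrite !mxE mulrC /= /dcoef /minor /cofactor; congr (_ * (_ * \det _)).
by apply/matrixP=> i k; rewrite !mxE.
Qed.

Lemma dualpair_frob_lt l : (l < m)%N -> dualpair (F l \o f) = 0.
Proof.
move=> lm; rewrite dualpairE.
have lm1 : (l.+1 < m.+1)%N by [].
apply: (@determinant_alternate _ _ _ ord0 (Ordinal lm1)) => // j.
by rewrite !mxE.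
Qed.

(** Moving the last row of the Moore matrix to the top changes its determinant only by a sign. *)
Lemma dualpair_frob_max : Delta != 0 -> dualpair (F m \o f) != 0.
Proof.
rewrite dualpairE /moore.
(* [g] is the cyclic permutation of the rows: row [i] of the determinant [dualpair] is row [g i] of
   the Moore matrix. *)
pose g (i : 'I_m.+1) : 'I_m.+1 := if i == 0 :> nat then ord_max else inord i.-1.
have g_inj : injective g.
  move=> i j; rewrite /g.
  have i1 : (i.-1 < m.+1)%N by case: i => i /=; lia.
  have j1 : (j.-1 < m.+1)%N by case: j => j /=; lia.
  case: eqP => i0; case: eqP => j0 /(congr1 val) /=; rewrite ?inordK // => E;
    apply/val_inj => /=; have := ltn_ord i; have := ltn_ord j; lia.
set M := \matrix_(i < _, j < _) _ => M0; set M' := \det _.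
suff -> : M' = (-1) ^+ perm g_inj * \det M by rewrite mulf_eq0 signr_eq0.
rewrite -det_perm -det_mulmx -row_permE; congr (\det _); apply/matrixP=> i j.
rewrite !mxE permE /g; case: ifP => // i0; rewrite inordK //.
by apply: leq_ltn_trans (leq_pred i) (ltn_ord i).
Qed.

(** Deleting row 0 and column j of the Moore matrix leaves the Frobenius twist of the Moore matrix
    of [hat f j]; hence the sum is the expansion of [Delta] along row 0. *)
Lemma dcoef_frob1 : \sum_j F 1 (d j) * f j = Delta.
Proof.
rewrite /moore (expand_det_row _ ord0); apply: eq_bigr => j _.
rewrite !mxE mulrC expr1; congr (_ * _).
rewrite /cofactor rmorphM rmorph_sign /= add0n; congr (_ * _).
rewrite /minor /moore -det_map_mx; congr (\det _); apply/matrixP=> i k.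
by rewrite !mxE /= frobE -exprM -expnD addn1.
Qed.

(** This is [F k] applied to the orthogonality of [d] and [F (l - k) \o f]. *)
Lemma pair_frob_le k l : (k <= l)%N -> (l < k + m)%N ->
  \sum_j F k (d j) * F l (f j) = 0.
Proof.
move=> kl lk; have lkm : (l - k < m)%N by lia.
transitivity (F k (dualpair (F (l - k) \o f))); last first.
  by rewrite dualpair_frob_lt ?rmorph0.
by rewrite rmorph_sum; apply: eq_bigr => j _;
  rewrite [RHS]rmorphM /= frob_comp subnKC.
Qed.

Lemma pair_frobS k : \sum_j F k.+1 (d j) * F k (f j) = F k Delta.
Proof.
rewrite -dcoef_frob1 rmorph_sum; apply: eq_bigr => j _.
by rewrite [RHS]rmorphM /= frob_comp addn1.
Qed.

Definition dmx : 'M[K]_m.+1 := \matrix_(k, j) F k (d j).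

Lemma det_dmx : \det dmx = moore p d. Proof. by []. Qed.

(** Multiplied by the transposed Moore matrix of [f] with its last column moved to the front, [dmx]
    becomes lower triangular. Its diagonal entries are the nonzero pairing of [d] with [F m \o f],
    and Frobenius powers of [Delta]. *)
Lemma moore_dcoef_neq0 : Delta != 0 -> moore p d != 0.
Proof.
move=> D0; rewrite -det_dmx.
pose M := \matrix_(j < m.+1, i < m.+1)
  if i == 0 :> nat then F m (f j) else F i.-1 (f j).
have E k l : (dmx *m M) k l =
  \sum_j F k (d j) * F (if l == 0 :> nat then m else l.-1) (f j).
  by rewrite mxE; apply: eq_bigr => j _; rewrite !mxE; case: ifP.
have: \det (dmx *m M) != 0.
  rewrite det_trig; last first.
    apply/is_trig_mxP => k l kl; rewrite E pair_frob_le //; case: eqP => l0;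
      try lia.
    have := ltn_ord l; lia.
  apply/prodf_neq0 => k _; rewrite E; case: (posnP k) => k0.
    rewrite k0 /=; have := dualpair_frob_max D0; rewrite /dualpair.
    by under eq_bigr do rewrite -[d _]expr1.
  rewrite -(prednK k0) /=.
  by rewrite pair_frobS expf_neq0.
by rewrite det_mulmx mulf_eq0 negb_or => /andP[].
Qed.

End Dual.

(** * The coefficients of Q *)

Section DualPolynomial.
Variables (K : fieldType) (p : nat) (pK : p \in [pchar K]).
Variables (m : nat) (f : 'I_m.+1 -> K).
Hypothesis f_indep : moore p f != 0.

Local Notation F := (frob pK).
Local Notation d := (dcoef p f).
Local Notation Delta := (moore p f).

Lemma dmx_unit : dmx pK f \in unitmx.
Proof. by rewrite unitmxE unitfE det_dmx moore_dcoef_neq0. Qed.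

Lemma frob_dcoef k j : F k (d j) = (-1) ^+ j * F k (minor p f j).
Proof. by rewrite rmorphM rmorph_sign. Qed.

(** The signs in [d] are fixed by Frobenius, so they factor out of [dmx] as a diagonal matrix. *)
Lemma moore_minor_neq0 : moore p (minor p f) != 0.
Proof.
have := moore_dcoef_neq0 pK f_indep; apply: contra => /eqP D0.
rewrite -(det_dmx pK).
have -> : dmx pK f = (\matrix_(k < m.+1, j < m.+1) minor p f j ^+ (p ^ k))
    *m diag_mx (\row_j (-1) ^+ j).
  by apply/matrixP=> k j; rewrite mul_mx_diag !mxE frob_dcoef mulrC.
by rewrite det_mulmx; move: D0; rewrite /moore => ->; rewrite mul0r.
Qed.

(** The coefficient of W^(p^k) in Q, read off the expansion of the numerator along its last
    column. *)
Definition qcoef (k : nat) : K :=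
  (moore p (minor p f))^-1 * ((-1) ^+ (k + m.+1) * moore_omit p k (minor p f)).

Lemma qcoef_max : qcoef m.+1 = 1.
Proof.
by rewrite /qcoef addnn -signr_odd odd_double mul1r moore_omit_max mulVf
  ?moore_minor_neq0.
Qed.

Lemma qcoef_dcoef j : \sum_(k < m.+2) qcoef k * F k (d j) = 0.
Proof.
have E := moore_linear_rec p (minor p f) j.
transitivity ((moore p (minor p f))^-1 * (-1) ^+ j *
  \sum_(k < m.+2) (-1) ^+ (k + m.+1) * moore_omit p k (minor p f)
    * minor p f j ^+ (p ^ k)); last by rewrite E mulr0.
rewrite mulr_sumr; apply: eq_bigr => k _.
by rewrite frob_dcoef /qcoef frobE; ring.
Qed.

Lemma QpolyE : Qpoly p f =
  \sum_(k < m.+2) qcoef k *: 'X^(p ^ k) - (F m Delta)%:P.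
Proof.
rewrite /Qpoly /=; congr (_ - _).
rewrite (_ : moore p _ = moore p (snoc (polyC \o minor p f) 'X)) // moore_snoc.
rewrite scaler_sumr; apply: eq_bigr => k _.
rewrite moore_omit_rmorph /= -[(-1) ^+ _](rmorph_sign (@polyC K)) -polyCM.
by rewrite mul_polyC scalerA.
Qed.

(** The difference of two monic additive polynomials of degree p^(m+1) vanishing on the [d j] has
    lower degree; its coefficients form a row vector killed by the invertible matrix [dmx]. *)
Lemma qcoef_unique (c : nat -> K) : c m.+1 = 1 ->
  (forall j, \sum_(k < m.+2) c k * F k (d j) = 0) ->
  forall k : 'I_m.+2, c k = qcoef k.
Proof.
move=> c1 cd; pose u := \row_(k < m.+1) (c k - qcoef k).
have : u *m dmx pK f = 0.
  apply/rowP=> j; rewrite !mxE.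
  have : \sum_(k < m.+2) c k * F k (d j) - \sum_(k < m.+2) qcoef k * F k (d j)
    = 0.
    by rewrite cd qcoef_dcoef subrr.
  rewrite -sumrB.
  rewrite big_ord_recr /= c1 qcoef_max subrr addr0 => E.
  by rewrite -[RHS]E; apply: eq_bigr => k _; rewrite !mxE mulrBl.
move/(congr1 (mulmx^~ (invmx (dmx pK f)))); rewrite mulmxK ?dmx_unit // mul0mx.
move=> /rowP u0 k; case: (unliftP ord_max k) => [i ->|->];
  last by rewrite /= c1 qcoef_max.
have := u0 i; rewrite !mxE /= => /eqP;
  rewrite subr_eq0 /bump leqNgt ltn_ord add0n.
by move/eqP.
Qed.

Let M := \matrix_(k < m.+1, j < m.+1) F k (f j).
Let G := invmx M.

Let M_unit : M \in unitmx. Proof. by rewrite unitmxE unitfE. Qed.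

Let pairG (l k : 'I_m.+1) : \sum_j F l (f j) * G j k = (l == k)%:R.
Proof.
have := congr1 (fun A : 'M_m.+1 => A l k) (mulmxV M_unit).
by rewrite !mxE => <-; apply: eq_bigr => j _; rewrite !mxE.
Qed.

(** The coefficients of the monic additive polynomial vanishing on the [f j]; their opposites form
    the last row of the companion matrix. *)
Let acoef (k : nat) : K := (-1) ^+ (k + m.+1) * moore_omit p k f / Delta.

Let frob_rec j : F m.+1 (f j) = - \sum_(k < m.+1) acoef k * F k (f j).
Proof.
have := moore_linear_rec p f j; rewrite big_ord_recr /= moore_omit_max.
rewrite addnn -signr_odd odd_double mul1r => /eqP; rewrite addr_eq0 => /eqP E.
apply: (mulfI f_indep); rewrite mulrN mulr_sumr.
rewrite -[LHS]opprK -{}E; congr (- _); apply: eq_bigr => k _.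
by rewrite /acoef frobE; field.
Qed.

(* The Frobenius twist of M is [C *m M] with C a companion matrix; hence
   [G = F(G) *m C], which read column by column is this recursion. *)
Let G_rec j (k : 'I_m.+1) :
  G j k = (if k == 0 :> nat then 0 else F 1 (G j (inord k.-1)))
          - acoef k * F 1 (G j ord_max).
Proof.
pose H := \matrix_(j < m.+1, k < m.+1)
  ((if k == 0 :> nat then 0 else F 1 (G j (inord k.-1)))
          - acoef k * F 1 (G j ord_max)).
suff E : G = H by rewrite {1}E mxE.
have FM : map_mx (F 1) M \in unitmx by rewrite map_unitmx.
(* The two sides are compared after multiplication on the left by the invertible matrix F(M). *)
apply: (can_inj (mulKmx FM)); apply/matrixP=> l {j}k; rewrite !mxE.
under eq_bigr do rewrite !mxE frob_comp add1n.
under [RHS]eq_bigr do rewrite !mxE mulrBr frob_comp add1n.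
have F1 (i : 'I_m.+1) : \sum_j F l.+1 (f j) * F 1 (G j i) = (l == i)%:R.
  rewrite -(rmorph_nat (F 1)) -pairG rmorph_sum; apply: eq_bigr => j _.
  by rewrite [RHS]rmorphM /= frob_comp add1n.
rewrite sumrB.
under [X in _ = _ - X]eq_bigr do rewrite mulrCA.
rewrite -mulr_sumr F1.
have -> : \sum_(i < m.+1) F l.+1 (f i) *
    (if k == 0 :> nat then 0 else F 1 (G i (inord k.-1))) = (l.+1 == k)%:R.
  case: (posnP k) => k0.
    by rewrite big1 ?k0 // => j _; rewrite mulr0.
  rewrite F1; congr (_%:R); rewrite -val_eqE /= inordK; first by lia.
  by have := ltn_ord k; lia.
(* For l < m, row l of F(M) is row l + 1 of M; only the last row calls for the relation
   [frob_rec]. *)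
case: (unliftP ord_max l) => [i ->|->].
  rewrite /= /bump leqNgt ltn_ord add0n.
  have im : (i.+1 < m.+1)%N by rewrite ltnS ltn_ord.
  rewrite -(pairG (Ordinal im)) -val_eqE /= /bump leqNgt ltn_ord add0n.
  by rewrite (ltn_eqF (ltn_ord i)) mulr0 subr0.
rewrite eqxx mulr1 /= (gtn_eqF (ltn_ord k)) sub0r.
under eq_bigr do rewrite frob_rec mulNr mulr_suml.
rewrite sumrN exchange_big /=; congr (- _).
under eq_bigr do under eq_bigr do rewrite -mulrA.
under eq_bigr do rewrite -mulr_sumr pairG.
rewrite (bigD1 k) //= eqxx mulr1 big1 ?addr0 // => i /negPf ->.
by rewrite mulr0.
Qed.

(** Unrolling [G_rec] expresses every column of [G] through the last one; at t = m this becomes an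
    additive equation satisfied by the last column itself. *)
Let G_iter j (t : nat) : (t < m.+1)%N ->
  G j (inord t) =
  - \sum_(k < t.+1) F (t - k) (acoef k) * F (t - k).+1 (G j ord_max).
Proof.
elim: t => [|t IHt] tm; rewrite G_rec inordK //=.
  by rewrite big_ord1 sub0r subnn [F 0 _]expr1.
rewrite (IHt (ltnW tm)) [in RHS]big_ord_recr /= opprD subnn [F 0 _]expr1;
  congr (_ - _).
rewrite rmorphN rmorph_sum; congr (- _); apply: eq_bigr => k _.
rewrite rmorphM /= !frob_comp !add1n subSn //.
by rewrite -ltnS ltn_ord.
Qed.

(** The last column of the inverse consists of the cofactors of the last row of [M], which are the
    [d j] up to a common sign. *)
Let G_max j : G j ord_max = (-1) ^+ m * d j / Delta.
Proof.
rewrite /G /invmx M_unit !mxE mulrC; congr (_ / _).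
rewrite /cofactor /dcoef mulrA exprD; congr (_ * \det _).
by apply/matrixP=> a b; rewrite !mxE /= /bump leqNgt ltn_ord.
Qed.

(** The announced coefficients, with Frobenius twists of [Delta] in place of its powers. At i = m
    the formula gives 1, because Delta[0] is the p-th power of [Delta]. *)
Definition qexpl (k : nat) : K :=
  if k is i.+1 then
    (-1) ^+ (m - i) * (F m Delta / (F i Delta * F i.+1 Delta))
      * F i (moore_omit p (m - i) f)
  else (-1) ^+ m.+1 * (F m Delta / Delta).

(** By [qcoef_unique] it suffices that these coefficients annihilate the [d j], which is [G_iter] at
    t = m after substituting [G_max]. *)
Lemma qexpl_qcoef (k : 'I_m.+2) : qexpl k = qcoef k.
Proof.
apply: qcoef_unique => [|j].
  rewrite /= subnn mul1r (moore_omit0 pK) frob_comp addn1.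
  have := f_indep; have : F m Delta != 0 by rewrite expf_neq0.
  have : F m.+1 Delta != 0 by rewrite expf_neq0.
  by move=> A B C; field; rewrite A B.
have := G_iter j (ltnSn m).
rewrite (_ : inord m = ord_max); last by apply/val_inj; rewrite /= inordK.
move/eqP; rewrite -addr_eq0 (reindex_inj rev_ord_inj) /= => /eqP E.
move: E; set S := (X in X = 0) => S0.
(* This factor turns the coefficient of [F m.+1 (d j)] in the relation into 1. *)
transitivity ((-1) ^+ m * (-1) ^+ m.+1 * F m Delta * S);
  last by rewrite S0 mulr0.
rewrite /S {S S0} big_ord_recl mulrDr /=; congr (_ + _).
  rewrite G_max [F 0 _]expr1.
  rewrite (_ : (-1) ^+ m * _ * _ * _ =
    ((-1) ^+ m * (-1) ^+ m) * ((-1) ^+ m.+1 * (F m Delta / Delta)) * d j);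
    last by ring.
  by rewrite -expr2 sqrr_sign mul1r.
rewrite mulr_sumr; apply: eq_bigr => i _.
have im : (i <= m)%N by rewrite -ltnS ltn_ord.
have -> : (m - (m.+1 - i.+1) = i)%N by lia.
rewrite /bump /= add1n subSS G_max /acoef.
rewrite !(rmorphM (F _), fmorphV (F _)) /= !rmorph_sign.
have -> : (-1) ^+ (m - i + m.+1) = (-1) ^+ i.+1 :> K.
  by rewrite -signr_odd -[RHS]signr_odd; congr (_ ^+ nat_of_bool _); lia.
have -> : (-1) ^+ (m - i) = (-1) ^+ m.+1 * (-1) ^+ i.+1 :> K.
  by rewrite -exprD -signr_odd -[RHS]signr_odd; congr (_ ^+ nat_of_bool _); lia.
have s2 : (-1) ^+ m * (-1) ^+ m = 1 :> K by rewrite -expr2 sqrr_sign.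
have A : F i Delta != 0 by rewrite expf_neq0.
have B : F i.+1 Delta != 0 by rewrite expf_neq0.
transitivity ((-1) ^+ m * (-1) ^+ m * ((-1) ^+ m.+1 * (-1) ^+ i.+1 *
  (F m Delta / (F i Delta * F i.+1 Delta)) *
  F i (moore_omit p (m - i) f) * ((-1) ^+ j * F i.+1 (minor p f j)))).
  by rewrite s2 mul1r.
by field; rewrite A B.
Qed.

End DualPolynomial.

(** * Roots of Q and solutions of the equations in a K-algebra *)

Section Solutions.
Variables (K : fieldType) (p : nat) (pK : p \in [pchar K]).
Variables (m : nat) (f : 'I_m.+1 -> K).
Variable B : comAlgType K.

Lemma pchar_alg : p \in [pchar B]. Proof. by rewrite pchar_lalg. Qed.

Local Notation F := (frob pK).
Local Notation FB := (frob pchar_alg).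
Local Notation d := (dcoef p f).
Local Notation Delta := (moore p f).

Lemma frobZ k (a : K) (x : B) : FB k (a *: x) = F k a *: FB k x.
Proof. exact: exprZn. Qed.

Lemma frob_alg k (a : K) : FB k a%:A = (F k a)%:A.
Proof. by rewrite frobZ rmorph1. Qed.

Lemma frob_AS (a : K) (x : B) k : x ^+ p - x = a%:A ->
  FB k x = x + (\sum_(i < k) F i a)%:A.
Proof.
move=> xa; elim: k => [|k IHk];
  first by rewrite big_ord0 scale0r addr0 [LHS]expr1.
have -> : FB k.+1 x = FB k (x + a%:A).
  by rewrite -xa addrC subrK -[x ^+ p]/(FB 1 x) frob_comp addn1.
by rewrite rmorphD /= IHk frob_alg big_ord_recr /= scalerDl addrA.
Qed.

Section Forward.
Variable w : 'I_m.+1 -> B.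
Hypothesis wAS : forall j, w j ^+ p - w j = (f j)%:A.

(** [FB m (w j)] is [FB k (w j)] plus the sum of the [F (k + i) (f j)] for i < m - k, and these
    terms pair to zero with [F k \o d]. *)
Lemma dual_system k : (k <= m)%N ->
  \sum_j F k (d j) *: FB m (w j) = FB k (\sum_j d j *: w j).
Proof.
move=> km; rewrite rmorph_sum /=; under [RHS]eq_bigr do rewrite frobZ.
have -> : \sum_j F k (d j) *: FB m (w j) =
    \sum_j F k (d j) *: FB k (w j) +
    (\sum_j F k (d j) * \sum_(i < m - k) F (k + i) (f j))%:A.
  rewrite scaler_suml -big_split; apply: eq_bigr => j _ /=.
  rewrite -scalerA -scalerDr; congr (_ *: _).
  rewrite -(subnKC km) -frob_comp (frob_AS _ (wAS j)) rmorphD /=; congr (_ + _).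
  rewrite frob_alg rmorph_sum addKn; congr (_ *: _).
  by apply: eq_bigr => i _; rewrite /= frob_comp.
rewrite -[RHS]addr0; congr (_ + _).
under eq_bigr do rewrite mulr_sumr.
rewrite exchange_big big1 ?scale0r // => i _.
by rewrite pair_frob_le ?leq_addr // ltn_add2l; have := ltn_ord i; lia.
Qed.

(** One more Frobenius adds [F m (f j)] to [FB m (w j)], and its pairing with [F m.+1 \o d] is no
    longer zero but [F m Delta]. *)
Lemma dual_system_top :
  \sum_j F m.+1 (d j) *: FB m (w j) + (F m Delta)%:A =
  FB m.+1 (\sum_j d j *: w j).
Proof.
rewrite [RHS]rmorph_sum -pair_frobS scaler_suml -big_split;
  apply: eq_bigr => j _ /=.
rewrite frobZ -scalerA -scalerDr; congr (_ *: _).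
by rewrite -addn1 -frob_comp (@frob_AS (f j) _ 1) // big_ord1 [F 0 _]expr1
  rmorphD /= frob_alg.
Qed.

End Forward.

Hypothesis f_indep : moore p f != 0.

(** Cramer's rule for the system with matrix [dmx]. Its right-hand side consists of the Frobenius
    powers of [z], so the matrix with column [i] replaced is again a Moore matrix. *)
Lemma moore_set_dcoef (z : B) (x : 'I_m.+1 -> B) :
  (forall k : 'I_m.+1, \sum_j F k (d j) *: x j = FB k z) -> forall i,
  (moore p d)^-1 *: moore p (fun k => if k == i then z else (d k)%:A) = x i.
Proof.
move=> xz i; rewrite moore_set_col.
set A := \matrix_(k, j) _.
transitivity ((moore p d)^-1 *:
    \sum_k (\sum_j A k j * x j) * cofactor A k i); last first.
  rewrite cramer_cofactor (_ : \det A = (moore p d)%:A).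
    by rewrite mulr_algl scalerA mulVf ?scale1r ?moore_dcoef_neq0.
  by rewrite -[RHS]/(in_alg B _) -moore_rmorph.
congr (_ *: _); apply: eq_bigr => k _; congr (_ * _); rewrite -[LHS]xz.
apply: eq_bigr => j _; rewrite !mxE -[_ *: x j]mulr_algl; congr (_ * _).
by rewrite -[RHS]/(FB k _) frob_alg.
Qed.

Lemma horner_Qpoly (z : B) : horner_alg z (Qpoly p f) =
  \sum_(k < m.+2) qcoef p f k *: FB k z - (F m Delta)%:A.
Proof.
rewrite (QpolyE pK) rmorphB rmorph_sum /= horner_algC; congr (_ - _).
by apply: eq_bigr => k _; rewrite linearZ /= rmorphXn /= horner_algX mulr_algl.
Qed.

(* Q(z) only sees the defect of the last equation of the dual system. *)
Lemma horner_Qpoly_system (z : B) (x : 'I_m.+1 -> B) :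
  (forall k : 'I_m.+1, \sum_j F k (d j) *: x j = FB k z) ->
  horner_alg z (Qpoly p f) =
  FB m.+1 z - \sum_j F m.+1 (d j) *: x j - (F m Delta)%:A.
Proof.
move=> xz; rewrite horner_Qpoly; congr (_ - _).
rewrite big_ord_recr /= (qcoef_max pK) // scale1r addrC; congr (_ + _).
under eq_bigr do rewrite -xz scaler_sumr.
rewrite exchange_big -sumrN; apply: eq_bigr => j _ /=.
under eq_bigr do rewrite scalerA.
rewrite -scaler_suml -scaleNr; congr (_ *: _).
have := qcoef_dcoef pK f j; rewrite big_ord_recr /= (qcoef_max pK) // mul1r.
by move/eqP; rewrite addr_eq0 => /eqP.
Qed.

Lemma Qpoly_dual_root (w : 'I_m.+1 -> B) :
  (forall j, w j ^+ p - w j = (f j)%:A) ->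
  horner_alg (\sum_j d j *: w j) (Qpoly p f) = 0.
Proof.
move=> wAS; rewrite (@horner_Qpoly_system _ (FB m \o w)) => [|k] /=.
  by rewrite -dual_system_top // addrAC addrK subrr.
by rewrite dual_system // -ltnS ltn_ord.
Qed.

Lemma Qpoly_root_dual (z : B) : horner_alg z (Qpoly p f) = 0 ->
  exists2 w : 'I_m.+1 -> B, forall j, w j ^+ p - w j = (f j)%:A
                          & z = \sum_j d j *: w j.
Proof.
move=> Qz; pose G := invmx (dmx pK f).
have dG (k i : 'I_m.+1) : \sum_j F k (d j) * G j i = (k == i)%:R.
  have := congr1 (fun A : 'M_m.+1 => A k i) (mulmxV (dmx_unit pK f_indep)).
  by rewrite !mxE => <-; apply: eq_bigr => j _; rewrite !mxE.
have Gd (k i : 'I_m.+1) : \sum_j G k j * F j (d i) = (k == i)%:R.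
  have := congr1 (fun A : 'M_m.+1 => A k i) (mulVmx (dmx_unit pK f_indep)).
  by rewrite !mxE => <-; apply: eq_bigr => j _; rewrite !mxE.
(* Solves the dual system for the expected values of [FB m (w j)]. *)
pose x j := \sum_(k < m.+1) G j k *: FB k z.
have xz (k : 'I_m.+1) : \sum_j F k (d j) *: x j = FB k z.
  under eq_bigr do rewrite scaler_sumr.
  rewrite exchange_big (bigD1 k) //= [X in _ + X]big1 => [|i ik].
    under eq_bigr do rewrite scalerA.
    by rewrite -scaler_suml dG eqxx scale1r addr0.
  under eq_bigr do rewrite scalerA.
  by rewrite -scaler_suml dG eq_sym (negPf ik) scale0r.
(* The hypothesis Q(z) = 0 enters only here, as the equation of index m + 1. *)
have xtop : FB m.+1 z = \sum_j F m.+1 (d j) *: x j + (F m Delta)%:A.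
  have := horner_Qpoly_system xz; rewrite Qz => /esym/eqP.
  by rewrite subr_eq0 subr_eq addrC => /eqP.
have xAS j : FB 1 (x j) - x j = (F m (f j))%:A.
  pose u j := FB 1 (x j) - x j - (F m (f j))%:A.
  suff: u j = 0 by move/eqP; rewrite subr_eq0 => /eqP.
  (* The equations of index 1 to m + 1, compared with the twists of those of index 0 to m, show that
     the twist of [dmx] kills the vector [u]. *)
  have u0 (k : 'I_m.+1) : \sum_j F k.+1 (d j) *: u j = 0.
    under eq_bigr do rewrite !scalerBr.
    rewrite !sumrB.
    have -> : \sum_i F k.+1 (d i) *: FB 1 (x i) = FB k.+1 z.
      rewrite -[RHS](frob_comp _ 1 k) -xz rmorph_sum; apply: eq_bigr => i _.
      by rewrite /= frobZ frob_comp.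
    have -> : \sum_i F k.+1 (d i) *: (F m (f i))%:A =
        (\sum_i F k.+1 (d i) * F m (f i))%:A :> B.
      by rewrite scaler_suml; apply: eq_bigr => i _; rewrite scalerA.
    case: (unliftP ord_max k) => [i ->|->].
      rewrite /= /bump leqNgt ltn_ord add0n.
      have im : (i.+1 < m.+1)%N by rewrite ltnS ltn_ord.
      by rewrite -(xz (Ordinal im)) subrr sub0r pair_frob_le ?scale0r ?oppr0
        //=; lia.
    by rewrite /= pair_frobS xtop addrAC addrK subrr.
  have GF1 k i : \sum_j F 1 (G k j) * F j.+1 (d i) = (k == i)%:R.
    rewrite -(rmorph_nat (F 1)) -Gd rmorph_sum; apply: eq_bigr => l _.
    by rewrite [RHS]rmorphM /= frob_comp.
  transitivity (\sum_(k < m.+1) F 1 (G j k) *: \sum_i F k.+1 (d i) *: u i).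
    under eq_bigr do rewrite scaler_sumr.
    rewrite exchange_big (bigD1 j) //= [X in _ + X]big1 => [|i ij].
      under eq_bigr do rewrite scalerA.
      by rewrite -scaler_suml GF1 eqxx scale1r addr0.
    under eq_bigr do rewrite scalerA.
    by rewrite -scaler_suml GF1 eq_sym (negPf ij) scale0r.
  by rewrite big1 // => k _; rewrite u0 scaler0.
(* As x_j stands for w_j^(p^m) = w_j + f_j + ... + f_j^(p^(m-1)), a subtraction recovers w_j and no
   p-th root is extracted. *)
exists (fun j => x j - (\sum_(k < m) F k (f j))%:A) => [j|].
  rewrite -[X in X - _ = _]/(FB 1 _) rmorphB /= frob_alg.
  have -> : FB 1 (x j) = x j + (F m (f j))%:A by rewrite -xAS addrC subrK.
  have E : F 1 (\sum_(k < m) F k (f j)) + f j =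
    \sum_(k < m) F k (f j) + F m (f j).
    transitivity (\sum_(k < m.+1) F k (f j)); last by rewrite big_ord_recr.
    rewrite big_ord_recl /= addrC [F 0 _]expr1; congr (_ + _).
    by rewrite rmorph_sum; apply: eq_bigr => i _; rewrite /= frob_comp.
  move: E; set S := \sum_(k < m) _ => /(congr1 (in_alg B));
    rewrite !rmorphD /= => E.
  by apply: (addrI (F 1 S)%:A); rewrite E; ring.
under eq_bigr do rewrite scalerBr scalerA.
rewrite sumrB -scaler_suml.
under [X in _ - X *: _]eq_bigr do rewrite mulr_sumr.
rewrite exchange_big [X in _ - X *: _]big1 => [|i _]; last first.
  rewrite -[RHS](@pair_frob_le _ _ pK _ f 0 i (leq0n _) (ltn_ord i)).
  by apply: eq_bigr => j _; rewrite [F 0 _]expr1.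
rewrite scale0r subr0 -[LHS]expr1 -[LHS]/(FB (ord0 : 'I_m.+1) z) -xz.
by apply: eq_bigr => j _; rewrite /= [F 0 _]expr1.
Qed.

End Solutions.

Lemma lrmorph_AS (K : fieldType) (p : nat) (B C : comAlgType K)
    (h : {lrmorphism B -> C}) (x : B) (a : K) :
  x ^+ p - x = a%:A -> h x ^+ p - h x = a%:A.
Proof. by move=> xa; rewrite -rmorphXn -rmorphB xa /= linearZ /= rmorph1. Qed.

(** * The universal property of Artin-Schreier algebras and étaleness *)

Section Universal.
Variables (K : fieldType) (p : nat) (pK : p \in [pchar K]).
Variables (m : nat) (g : 'I_m -> K).

Local Notation A := (ASalg pK g).

Lemma ASpi_surj (x : A) : exists q, x = ASpi pK g q.
Proof. by exists (repr x); rewrite /ASpi reprK. Qed.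

Lemma ASpi_eq0 q : ASpi pK g q = 0 <-> in_gen_ideal (ASpoly p g) q.
Proof.
have -> : (0 : A) = ASpi pK g 0 by rewrite rmorph0.
rewrite /ASpi; split=> [/eqP|H].
  by rewrite -Quotient.idealrBE subr0 => /asboolP.
by apply/eqP; rewrite -Quotient.idealrBE subr0; apply/asboolP.
Qed.

Fact ASpi_scalable : scalable (ASpi pK g).
Proof. by move=> a q; rewrite -mul_mpolyC rmorphM. Qed.
HB.instance Definition _ :=
  GRing.isScalable.Build K {mpoly K[m]} A *:%R (ASpi pK g) ASpi_scalable.

Lemma ASvarE k : ASvar pK g k ^+ p - ASvar pK g k = (g k)%:A.
Proof.
apply/eqP; rewrite -subr_eq0 /ASvar -rmorphXn -rmorphB.
have -> : (g k)%:A = ASpi pK g (g k)%:MP.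
  by rewrite -[RHS]mulr1.
rewrite -rmorphB; apply/eqP/ASpi_eq0.
exists (fun l => (l == k)%:R); rewrite (bigD1 k) //= eqxx mul1r big1 ?addr0 //.
by move=> l /negPf ->; rewrite mul0r.
Qed.

Section Lift.
Variables (B : comAlgType K) (b : 'I_m -> B).
Hypothesis bAS : forall k, b k ^+ p - b k = (g k)%:A.

(** Evaluation at the chosen representative; [ASlift_pi] shows that any other representative gives
    the same value. *)
Definition ASlift (x : A) : B := mmap (in_alg B) b (repr x).

Lemma ASlift_pi q : ASlift (ASpi pK g q) = mmap (in_alg B) b q.
Proof.
apply/eqP; rewrite /ASlift -subr_eq0 -rmorphB.
have /ASpi_eq0[c ->] : ASpi pK g (repr (ASpi pK g q) - q) = 0.
  by rewrite rmorphB /= {1}/ASpi reprK subrr.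
rewrite rmorph_sum big1 // => k _.
by rewrite rmorphM !rmorphB rmorphXn /= mmapX mmap1U mmapC bAS subrr mulr0.
Qed.

Fact ASlift_zmod_morphism : zmod_morphism ASlift.
Proof.
move=> x y; have [[q ->] [q' ->]] := (ASpi_surj x, ASpi_surj y).
by rewrite -rmorphB !ASlift_pi rmorphB.
Qed.

Fact ASlift_monoid_morphism : monoid_morphism ASlift.
Proof.
split=> [|x y]; first by rewrite -(rmorph1 (ASpi pK g)) ASlift_pi rmorph1.
have [[q ->] [q' ->]] := (ASpi_surj x, ASpi_surj y).
by rewrite -rmorphM !ASlift_pi rmorphM.
Qed.

Fact ASlift_scalable : scalable ASlift.
Proof.
move=> a x; have [q ->] := ASpi_surj x.
by rewrite -linearZ !ASlift_pi mmapZ mulr_algl.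
Qed.

Lemma ASlift_var k : ASlift (ASvar pK g k) = b k.
Proof. by rewrite /ASvar ASlift_pi mmapX mmap1U. Qed.

Lemma AS_universal :
  exists h : {lrmorphism A -> B}, forall k, h (ASvar pK g k) = b k.
Proof.
pose M1 := GRing.isZmodMorphism.Build _ _ ASlift ASlift_zmod_morphism.
pose M2 := GRing.isMonoidMorphism.Build _ _ ASlift ASlift_monoid_morphism.
pose M3 := GRing.isScalable.Build K A B *:%R ASlift ASlift_scalable.
pose h : {lrmorphism A -> B} := HB.pack ASlift M1 M2 M3.
by exists h => k; rewrite -ASlift_var.
Qed.

End Lift.

Lemma AS_hom_mmap (B : comAlgType K) (h : {lrmorphism A -> B}) q :
  h (ASpi pK g q) = mmap (in_alg B) (fun k => h (ASvar pK g k)) q.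
Proof.
elim/mpolyind: q => [|c M q _ _ IHq]; first by rewrite !rmorph0.
rewrite !rmorphD /= IHq; congr (_ + _).
rewrite mmapZ mmapX !linearZ /= mulr_algl; congr (_ *: _).
rewrite mpolyXE_id !rmorph_prod /mmap1; apply: eq_bigr => k _.
by rewrite !rmorphXn.
Qed.

Lemma AS_hom_ext (B : comAlgType K) (h h' : {lrmorphism A -> B}) :
  (forall k, h (ASvar pK g k) = h' (ASvar pK g k)) -> h =1 h'.
Proof.
move=> hh' x; have [q ->] := ASpi_surj x; rewrite !AS_hom_mmap.
rewrite /mmap; apply: eq_bigr => M _; congr (_ * _).
by apply: eq_bigr => k _; rewrite hh'.
Qed.

Lemma AS_gen (x : A) : exists q, x = mmap (in_alg A) (ASvar pK g) q.
Proof.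
have [q ->] := ASpi_surj x; exists q.
exact: (AS_hom_mmap (idfun : {lrmorphism A -> A})).
Qed.

Lemma mmap_closed (B : comAlgType K) (b : 'I_m -> B) (S : B -> Prop) :
  (forall a : K, S a%:A) -> (forall x y, S x -> S y -> S (x + y)) ->
  (forall x y, S x -> S y -> S (x * y)) -> (forall k, S (b k)) ->
  forall q, S (mmap (in_alg B) b q).
Proof.
move=> S1 SD SM Sb q; rewrite /mmap; apply: big_ind => //.
  by rewrite -(scale0r 1).
move=> M _; apply: (SM _ _ (S1 _)); apply: big_ind => //.
  by rewrite -(scale1r 1).
move=> k _; elim: (M k) => [|i IHi]; first by rewrite expr0 -(scale1r 1).
by rewrite exprS; apply: SM.
Qed.

(** If the kernel of [h] has square zero, x^p depends only on [h x], as p >= 2. A solution lifting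
    u(w_k) must therefore be b_k^p - g_k for any lift b_k, and this element is indeed a solution. *)
Lemma AS_etale : etale A.
Proof.
have p2 : (1 < p)%N := prime_gt1 (pcharf_prime pK).
split.
  exists m, (ASpi pK g : {lrmorphism {mpoly K[m]} -> A}).
  split=> [x|]; first by have [q ->] := ASpi_surj x; exists q.
  by exists m, (ASpoly p g) => q; apply: ASpi_eq0.
move=> B C h h_surj h_sq u.
have /choice[b hb] : forall k, exists y, h y = u (ASvar pK g k).
  by move=> k; apply: h_surj.
have uAS k : u (ASvar pK g k) ^+ p - u (ASvar pK g k) = (g k)%:A.
  exact/lrmorph_AS/ASvarE.
have frob_sq (x y : B) : h x = h y -> x ^+ p = y ^+ p.
  move=> hxy; have xy0 : h (x - y) = 0 by rewrite rmorphB /= hxy subrr.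
  apply/eqP; rewrite -subr_eq0; have := rmorphB (frob (pchar_alg pK B) 1) x y.
  rewrite /= !frobE expn1 => <-.
  by rewrite -(subnK p2) addn2 !exprS mulrA (h_sq _ _ xy0 xy0) mul0r.
pose v k := b k ^+ p - (g k)%:A.
have hv k : h (v k) = u (ASvar pK g k).
  by rewrite rmorphB rmorphXn /= linearZ /= rmorph1 hb -uAS opprB addrC subrK.
have vAS k : v k ^+ p - v k = (g k)%:A.
  by rewrite (@frob_sq (v k) (b k)) ?hv ?hb // /v opprB addrC subrK.
have [V hV] := AS_universal vAS; exists V; split=> [x|V' hV'].
  have E := @AS_hom_ext C (h \o V) u; apply: E => k /=.
  by rewrite hV hv.
apply: AS_hom_ext => k; rewrite hV /v.
have : V' (ASvar pK g k) ^+ p - V' (ASvar pK g k) = (g k)%:A.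
  exact/lrmorph_AS/ASvarE.
move=> <-; rewrite (@frob_sq (b k) (V' (ASvar pK g k))) ?opprB 1?addrC ?subrK
  //.
by rewrite hb; apply/esym/hV'.
Qed.

End Universal.

(** * The prime field inside rings of characteristic p *)

Section PrimeField.
Variables (p : nat) (p_pr : prime p).

Lemma val_FpD (a b : 'F_p) : (a + b : 'F_p) = ((a + b) %% p)%N :> nat.
Proof. exact: (congr1 (modn (a + b)%N) (Fp_cast p_pr)). Qed.

Lemma mulrn_modp (V : zmodType) (v : V) n :
  v *+ p = 0 -> v *+ (n %% p)%N = v *+ n.
Proof. by move=> vp; rewrite [in RHS](divn_eq n p) mulrnDr mulnC mulrnA vp
  mul0rn add0r. Qed.

Lemma mulrnFpD (V : zmodType) (v : V) (a b : 'F_p) : v *+ p = 0 ->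
  v *+ (a + b)%R = v *+ a + v *+ b.
Proof. by move=> vp; rewrite val_FpD mulrn_modp // mulrnDr. Qed.

Lemma mulrnFpB (V : zmodType) (v : V) (a b : 'F_p) : v *+ p = 0 ->
  v *+ (a - b)%R = v *+ a - v *+ b.
Proof. by move=> vp; apply/eqP; rewrite -subr_eq opprK -mulrnFpD // subrK. Qed.

Lemma val_Fp_lt (a : 'F_p) : (a < p)%N.
Proof. by have := ltn_ord a; rewrite {2}Fp_cast. Qed.

Lemma natrFp_eq0 (R : nzRingType) (pR : p \in [pchar R]) (a : 'F_p) :
  (a : nat)%:R = 0 :> R -> a = 0.
Proof.
move/eqP; rewrite -(dvdn_pcharf pR) => pa; apply/val_inj => /=.
by move: pa; rewrite /dvdn modn_small ?val_Fp_lt // => /eqP.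
Qed.

Lemma mulrn_pchar (R : nzRingType) (pR : p \in [pchar R]) (x : R) : x *+ p = 0.
Proof. by rewrite -mulr_natr (pcharf0 pR) mulr0. Qed.

Lemma natrFpX (R : nzRingType) (pR : p \in [pchar R]) n : n%:R ^+ p = n%:R :> R.
Proof. by rewrite -(pFrobenius_autE pR) pFrobenius_aut_nat. Qed.

(** The p elements of the prime field are already roots of X^p - X, so one more root would exceed
    the degree. *)
Lemma Frobenius_fixed (L : fieldType) (pL : p \in [pchar L]) (x : L) :
  x ^+ p = x -> exists c : 'F_p, x = (c : nat)%:R.
Proof.
move=> xp; pose s : seq L := [seq (c : nat)%:R | c : 'F_p].
case: (boolP (x \in s)) => [/mapP[c _ ->]|xs]; first by exists c.
have sX : size ('X^p - 'X : {poly L}) = p.+1.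
  by rewrite size_polyDl ?size_polyN ?size_polyX size_polyXn // ltnS prime_gt1.
have := @max_poly_roots _ ('X^p - 'X) (x :: s).
rewrite sX -size_poly_eq0 sX => /(_ isT); rewrite /= size_map -cardT card_Fp //.
rewrite ltnn => H; suff: false by []; apply: H; last first.
  rewrite xs map_inj_uniq ?enum_uniq // => a b /eqP; rewrite -subr_eq0.
  rewrite -(mulrnFpB a b (mulrn_pchar pL 1)) => /eqP /(natrFp_eq0 pL) /eqP.
  by rewrite subr_eq0 => /eqP.
rewrite rootE !hornerE xp subrr eqxx /=.
by apply/allP=> _ /mapP[c _ ->]; rewrite rootE !hornerE natrFpX ?subrr.
Qed.

End PrimeField.

(** * The degree of Q *)

Section QpolySize.
Variables (K : fieldType) (p : nat) (pK : p \in [pchar K]).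
Variables (m : nat) (f : 'I_m.+1 -> K).
Hypothesis f_indep : moore p f != 0.

Lemma Qpoly_lead : (size (Qpoly p f - 'X^(p ^ m.+1))%R <= p ^ m.+1)%N.
Proof.
have p_pr := pcharf_prime pK.
rewrite (QpolyE pK) big_ord_recr /= (qcoef_max pK) // scale1r.
rewrite addrAC addrK.
apply: leq_trans (size_polyD _ _) _; rewrite geq_max size_polyN.
rewrite (leq_trans (size_polyC_leq1 _)) ?expn_gt0 ?prime_gt0 ?andbT //.
apply: leq_trans (size_sum _ _ _) _; apply/bigmax_leqP => k _.
apply: leq_trans (size_scale_leq _ _) _; rewrite size_polyXn.
by rewrite ltn_exp2l ?prime_gt1.
Qed.

Lemma size_Qpoly : size (Qpoly p f) = (p ^ m.+1).+1.
Proof.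
rewrite -(subrK 'X^(p ^ m.+1) (Qpoly p f)) addrC size_polyDl size_polyXn //.
by rewrite ltnS Qpoly_lead.
Qed.

Lemma monic_Qpoly : Qpoly p f \is monic.
Proof.
rewrite -(subrK 'X^(p ^ m.+1) (Qpoly p f)) addrC monicE lead_coefDl
  ?lead_coefXn //.
by rewrite size_polyXn ltnS Qpoly_lead.
Qed.

End QpolySize.

(** K(z) is built as the quotient of K[X] by a nonzero polynomial of least degree vanishing at [z];
    minimality makes it irreducible. *)
Lemma simple_extension (K : fieldType) (Kalg : closedFieldType)
    (iota : {rmorphism K -> Kalg}) (z : Kalg) : algebraicOver iota z ->
  exists (L : fieldExtType K) (j : {rmorphism L -> Kalg}) (x : L),
    [/\ forall a : K, j a%:A = iota a, j x = z
      & forall y : L, exists q : {poly K}, y = horner_alg x q].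
Proof.
case=> q0 q0n0 q0z.
pose S n := `[< exists q : {poly K}, [/\ q != 0, root (map_poly iota q) z &
  size q = n] >].
have exS : exists n, S n by exists (size q0); apply/asboolP; exists q0.
case: (ex_minnP exS) => n /asboolP[q [qn0 qz sq]] qmin.
have irr_q : irreducible_poly q.
  apply/(subfx_irreducibleP qz qn0) => q' q'z q'n0; rewrite sq; apply: qmin.
  by apply/asboolP; exists q'.
pose L := SubFieldExtType qz irr_q.
exists L, (@subfx_inj _ _ iota z q), (subfx_root iota z q); split.
- exact: subfx_inj_base.
- exact: subfx_inj_root.
- by move=> y; have [q' ->] := subfxEroot qz qn0 y; exists q'.
Qed.

(** * The roots of Q and the field L *)

Section RootsOfQ.
Variables (K : fieldType) (p : nat) (pK : p \in [pchar K]).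
Variables (m : nat) (f : 'I_m.+1 -> K).
Hypothesis f_indep : moore p f != 0.
Variables (L : fieldExtType K) (alpha : 'I_m.+1 -> L).
Hypothesis alphaAS : forall k, alpha k ^+ p - alpha k = (f k)%:A.

Local Notation d := (dcoef p f).
Let p_pr : prime p := pcharf_prime pK.
Let pL : p \in [pchar L]. Proof. by rewrite pchar_lalg. Qed.

Lemma AS_translate (B : comAlgType K) (x : B) (a : K) n :
  x ^+ p - x = a%:A -> (x + n%:R) ^+ p - (x + n%:R) = a%:A.
Proof.
move=> xa; have := rmorphD (frob (pchar_alg pK B) 1) x n%:R.
rewrite /= !frobE !expn1 (natrFpX (pchar_alg pK B)) => ->.
by rewrite opprD addrACA subrr addr0.
Qed.

Definition Qroot (c : {ffun 'I_m.+1 -> 'F_p}) : L :=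
  \sum_j d j *: (alpha j + (c j : nat)%:R).

Lemma Qroot_root c : horner_alg (Qroot c) (Qpoly p f) = 0.
Proof. by apply: Qpoly_dual_root => // j; apply: AS_translate. Qed.

(** Frobenius fixes the coefficients of such a relation, so its successive twists form a linear
    system with the invertible matrix [dmx]. *)
Lemma dcoef_free (e : 'I_m.+1 -> 'F_p) :
  \sum_j d j * (e j : nat)%:R = 0 -> forall j, e j = 0.
Proof.
move=> de; pose u := \col_j (e j : nat)%:R : 'cV[K]_m.+1.
have : dmx pK f *m u = 0.
  apply/colP=> k; rewrite !mxE -[RHS](rmorph0 (frob pK k)) -[in RHS]de
    [RHS]rmorph_sum.
  by apply: eq_bigr => j _; rewrite !mxE [RHS]rmorphM /= rmorph_nat.
move/(congr1 (mulmx (invmx (dmx pK f)))); rewrite mulKmx ?dmx_unit // mulmx0.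
by move=> /colP u0 j; have := u0 j; rewrite !mxE => /(natrFp_eq0 p_pr pK).
Qed.

Lemma Qroot_inj : injective Qroot.
Proof.
move=> c c' cc'; apply/ffunP=> j; apply/eqP; rewrite -subr_eq0.
apply/eqP; apply: (@dcoef_free (fun j => c j - c' j)).
apply/eqP; rewrite -(fmorph_eq0 (in_alg L)); apply/eqP.
transitivity (Qroot c - Qroot c'); last by rewrite cc' subrr.
rewrite rmorph_sum /Qroot -sumrB; apply: eq_bigr => i _.
rewrite -scalerBr rmorphM rmorph_nat mulr_algl; congr (_ *: _).
by rewrite (mulrnFpB p_pr _ _ (mulrn_pchar pL 1)) opprD addrACA subrr add0r.
Qed.

(** The translates of [alpha] by vectors of the prime field give p^(m+1) distinct roots, as many as
    the degree. *)
Lemma Qpoly_split : map_poly (in_alg L) (Qpoly p f) =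
  \prod_(x <- [seq Qroot c | c : {ffun 'I_m.+1 -> 'F_p}]) ('X - x%:P).
Proof.
rewrite (@all_roots_prod_XsubC _ (map_poly (in_alg L) (Qpoly p f)) [seq Qroot c
  | c : {ffun 'I_m.+1 -> 'F_p}]).
- by rewrite lead_coef_map (monicP (monic_Qpoly pK f_indep)) rmorph1 scale1r.
- by rewrite size_map_poly size_Qpoly // size_map -cardT card_ffun card_Fp //
  card_ord.
- by apply/allP=> _ /mapP[c _ ->]; rewrite rootE; apply/eqP/Qroot_root.
- by rewrite uniq_rootsE map_inj_uniq ?enum_uniq //; apply: Qroot_inj.
Qed.

Hypothesis alpha_gen :
  forall y : L, exists q : {poly K}, y = horner_alg (\sum_j d j *: alpha j) q.

Lemma Qpoly_splittingFor :
  splittingFieldFor 1%VS (map_poly (in_alg L) (Qpoly p f)) {:L}.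
Proof.
exists [seq Qroot c | c : {ffun 'I_m.+1 -> 'F_p}].
  by rewrite Qpoly_split eqpxx.
apply/eqP; rewrite eqEsubv subvf; apply/subvP=> y _.
have [q ->] := alpha_gen y.
have zE : \sum_j d j *: alpha j = Qroot [ffun=> 0].
  by apply: eq_bigr => j _; rewrite ffunE addr0.
rewrite zE; apply: rpred_horner.
  by apply/polyOverP=> i; rewrite coef_map /= memvZ // rpred1.
apply: seqv_sub_adjoin; apply: map_f; exact: mem_enum.
Qed.

End RootsOfQ.

(** [Qpoly_root_dual] is applied inside K(z), so the [alpha] lie there; then all the [Qroot c] do
    too, and being distinct they make Q separable. *)
Lemma splitting_extension (K : fieldType) (p : nat) (pK : p \in [pchar K])
    (Kalg : closedFieldType) (iota : {rmorphism K -> Kalg})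
    (Kalg_algebraic : forall x : Kalg, algebraicOver iota x)
    (m : nat) (f : 'I_m.+1 -> K) (f_indep : moore p f != 0) :
  exists (L : splittingFieldType K) (j : {rmorphism L -> Kalg})
         (alpha : 'I_m.+1 -> L),
    [/\ forall a : K, j a%:A = iota a,
        forall k, alpha k ^+ p - alpha k = (f k)%:A,
        forall y : L, exists q : {poly K},
          y = horner_alg (\sum_j dcoef p f j *: alpha j) q
      & galois 1%VS {:L}].
Proof.
have p_pr := pcharf_prime pK.
have [z Qz] : exists z, root (map_poly iota (Qpoly p f)) z.
  apply/closed_rootP; rewrite size_map_poly size_Qpoly //.
  by rewrite eqSS -lt0n expn_gt0 prime_gt0.
have [L [j [x [jK jx xgen]]]] := simple_extension (Kalg_algebraic z).
have Qx : horner_alg x (Qpoly p f) = 0.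
  apply: (fmorph_inj j); rewrite rmorph0 -[horner_alg _ _]/((map_poly _ _).[_]).
  rewrite -horner_map -map_poly_comp jx (eq_map_poly jK).
  exact/eqP.
have [alpha alphaAS xE] := Qpoly_root_dual pK f_indep Qx.
rewrite xE in xgen.
have Qspl := Qpoly_splittingFor pK f_indep alphaAS xgen.
have QK : map_poly (in_alg L) (Qpoly p f) \is a polyOver 1%VS.
  by apply/polyOverP=> i; rewrite coef_map /= memvZ // rpred1.
have axL : splitting_field_axiom L by exists (map_poly (in_alg L) (Qpoly p f)).
pose LM := FieldExt_isSplittingField.Build K L axL.
pose L' : splittingFieldType K := HB.pack L LM.
exists L', j, alpha; split=> //.
apply/splitting_galoisField; exists (map_poly (in_alg L) (Qpoly p f));
  split=> //.
rewrite (Qpoly_split pK f_indep alphaAS) separable_prod_XsubC.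
by rewrite map_inj_uniq ?enum_uniq //; apply: Qroot_inj.
Qed.

(** * The embedding of the prime field as a ring morphism *)

Section PrimeFieldEmbedding.
Variables (R : nzRingType) (p : nat).

Definition Fpmor (pR : p \in [pchar R]) (c : 'F_p) : R := (c : nat)%:R.

Variable pR : p \in [pchar R].
Let p_pr := pcharf_prime pR.

Fact Fpmor_zmod_morphism : zmod_morphism (Fpmor pR).
Proof. by move=> a b;
  rewrite /Fpmor (mulrnFpB p_pr _ _ (mulrn_pchar pR 1)). Qed.

Fact Fpmor_monoid_morphism : monoid_morphism (Fpmor pR).
Proof.
split=> [|a b]; rewrite /Fpmor; first by [].
rewrite -natrM -(GRing.natr_mod_pchar pR (a * b)%N).
by congr (_%:R); exact: (congr1 (modn (a * b)%N) (Fp_cast p_pr)).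
Qed.

HB.instance Definition _ :=
  GRing.isZmodMorphism.Build 'F_p R (Fpmor pR) Fpmor_zmod_morphism.
HB.instance Definition _ :=
  GRing.isMonoidMorphism.Build 'F_p R (Fpmor pR) Fpmor_monoid_morphism.

Lemma mulrn_Fpmor (x : R) (c : 'F_p) : x *+ c = x * Fpmor pR c.
Proof. by rewrite mulr_natr. Qed.

End PrimeFieldEmbedding.

(** * The algebra A is generated by w *)

Section PrimitiveElement.
Variables (K : fieldType) (p : nat) (pK : p \in [pchar K]).
Variables (m : nat) (f : 'I_m.+1 -> K).
Hypothesis f_indep : moore p f != 0.

Local Notation d := (dcoef p f).
Local Notation A := (ASalg pK f).
Local Notation wi := (ASvar pK f).
Local Notation w := (wdet p f wi).

Lemma ASvar_formula i :
  wi i = (moore p d)^-1 *: moore p (fun k => if k == i then w else (d k)%:A)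
         - (\sum_(k < m) f i ^+ (p ^ k))%:A.
Proof.
rewrite wdetE (@moore_set_dcoef _ _ pK _ f _ f_indep _ (fun j => frob
  (pchar_alg pK A) m (wi j))).
  by rewrite (frob_AS pK m (ASvarE pK f i)) addrK.
move=> k; apply: dual_system; last by rewrite -ltnS ltn_ord.
exact: ASvarE.
Qed.

Lemma ASvar_horner i : exists q : {poly K}, wi i = horner_alg w q.
Proof.
(* The right-hand side of [ASvar_formula] with the variable in place of [w]. *)
exists ((moore p d)^-1 *: moore p (fun k => if k == i then 'X else (d k)%:P)
         - (\sum_(k < m) f i ^+ (p ^ k))%:P).
rewrite {1}ASvar_formula [RHS]rmorphB /= horner_algC; congr (_ - _).
rewrite [RHS]linearZ /= mulr_algl; congr (_ *: _).
rewrite -(moore_rmorph p (horner_alg w)) /moore.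
congr (\det _); apply/matrixP=> a b; rewrite !mxE; congr (_ ^+ _).
by rewrite /=; case: eqP => _; rewrite ?horner_algX ?horner_algC.
Qed.

Lemma AS_horner (x : A) : exists q : {poly K}, x = horner_alg w q.
Proof.
have [q ->] := AS_gen x;
  apply: (mmap_closed (S := fun x => exists q, x = horner_alg w q)).
- by move=> a; exists a%:P; rewrite horner_algC.
- by move=> _ _ [a ->] [b ->]; exists (a + b); rewrite rmorphD.
- by move=> _ _ [a ->] [b ->]; exists (a * b); rewrite rmorphM.
- exact: ASvar_horner.
Qed.

Lemma wdet_root : horner_alg w (Qpoly p f) = 0.
Proof. by rewrite wdetE; apply: Qpoly_dual_root => // j; apply: ASvarE. Qed.

End PrimitiveElement.

(** * Relations between the solutions in L *)

Section Structure.
Variables (K : fieldType) (p : nat) (pK : p \in [pchar K]).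
Variables (m : nat) (f : 'I_m.+1 -> K).
Hypothesis f_indep : moore p f != 0.
Variables (L : splittingFieldType K) (alpha : 'I_m.+1 -> L).
Hypothesis alphaAS : forall k, alpha k ^+ p - alpha k = (f k)%:A.
Hypothesis alpha_gen : forall y : L, exists q : {poly K},
  y = horner_alg (\sum_j dcoef p f j *: alpha j) q.
Hypothesis galL : galois 1%VS {:L}.
Variables (r : nat) (e : 'I_r -> 'I_m.+1).
Hypothesis e_inj : injective e.
Hypothesis fe_free : forall (c : 'I_r -> 'F_p) (y : K),
  \sum_k f (e k) *+ c k = y ^+ p - y -> forall k, c k = 0.
Hypothesis fe_span : forall j, exists (c : 'I_r -> 'F_p) (y : K),
  f j = \sum_k f (e k) *+ c k + (y ^+ p - y).

Local Notation d := (dcoef p f).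
Local Notation A := (ASalg pK f).
Local Notation AI := (ASalg pK (fun k => f (e k))).
Let p_pr : prime p := pcharf_prime pK.
Let pL : p \in [pchar L]. Proof. by rewrite pchar_lalg. Qed.
Local Notation i_ := (Fpmor pL).

Lemma AS_comb (B : comAlgType K) (a : 'I_r -> B) (g : 'I_r -> K)
    (c : 'I_r -> 'F_p) (y : K) :
  (forall k, a k ^+ p - a k = (g k)%:A) ->
  (\sum_k a k *+ c k + y%:A) ^+ p - (\sum_k a k *+ c k + y%:A) =
  (\sum_k g k *+ c k + (y ^+ p - y))%:A.
Proof.
move=> aAS; have FE (x : B) : x ^+ p = frob (pchar_alg pK B) 1 x by [].
rewrite FE rmorphD rmorph_sum opprD addrACA scalerDl.
congr (_ + _); last by rewrite /= frob_alg scalerBl.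
rewrite -sumrB scaler_suml; apply: eq_bigr => k _.
by rewrite raddfMn /= -mulrnBl -FE aAS scalerMnl.
Qed.

Lemma AS_diff (x y : L) (a : K) : x ^+ p - x = a%:A -> y ^+ p - y = a%:A ->
  exists c : 'F_p, x = y + i_ c.
Proof.
move=> xa ya; have [c cE] : exists c : 'F_p, x - y = i_ c.
  apply: (Frobenius_fixed p_pr pL).
  rewrite -[LHS]/(frob pL 1 _) rmorphB /= -[frob _ _ x]/(x ^+ p) -[frob _ _
    y]/(y ^+ p).
  rewrite -[x ^+ p](subrK x) -[y ^+ p](subrK y) xa ya.
  by rewrite opprD addrACA subrr add0r.
by exists c; rewrite -cE addrC subrK.
Qed.

(** The combination dictated by [fe_span] solves the same equation as [alpha j], so the two differ
    by an element of the prime field, which is absorbed into [y]. *)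
Lemma alpha_rel j : exists (c : 'I_r -> 'F_p) (y : K),
  alpha j = \sum_k alpha (e k) *+ c k + y%:A.
Proof.
have [c [y fj]] := fe_span j.
have H := AS_comb c y (fun k => alphaAS (e k)); rewrite -fj in H.
have [c0 c0E] := AS_diff (alphaAS j) H.
exists c, (y + (c0 : nat)%:R); rewrite c0E scalerDl addrA; congr (_ + _).
by rewrite -[RHS]/(in_alg L _) rmorph_nat.
Qed.

(** * The Galois group of L *)

Local Notation gT := (gal_of {:L}).

Lemma gal_alpha (s : gT) j : exists c : 'F_p, s (alpha j) = alpha j + i_ c.
Proof.
apply: (AS_diff _ (alphaAS j)).
by rewrite -rmorphXn -rmorphB alphaAS /= linearZ /= rmorph1.
Qed.

(** The default 0 is never taken, by [gal_alpha]. *)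
Definition gal_shift (s : gT) (j : 'I_m.+1) : 'F_p :=
  odflt 0 [pick c | s (alpha j) == alpha j + i_ c].

Lemma gal_shiftE (s : gT) j : s (alpha j) = alpha j + i_ (gal_shift s j).
Proof.
rewrite /gal_shift; case: pickP => [c /eqP //|] H.
by have [c /eqP] := gal_alpha s j; rewrite H.
Qed.

Lemma gal_i (s : gT) c : s (i_ c) = i_ c. Proof. exact: rmorph_nat. Qed.

Definition galvec (s : gT) : 'rV['F_p]_r := \row_k gal_shift s (e k).

Lemma galvecM : {in [set: gT] &, {morph galvec : s t / (s * t)%g}}.
Proof.
move=> s t _ _; apply/rowP=> k; rewrite !mxE.
apply: (fmorph_inj i_); apply: (addrI (alpha (e k))).
rewrite -gal_shiftE galM ?memvf // gal_shiftE rmorphD /= gal_i gal_shiftE.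
by rewrite rmorphD /= addrAC addrA.
Qed.

Canonical galvec_morphism := Morphism galvecM.

Lemma gal_ext (s t : gT) :
  (forall j, s (alpha j) = t (alpha j)) -> s = t.
Proof.
move=> st; apply/eqP/gal_eqP=> y _; have [q ->] := alpha_gen y.
have E (u : gT) x : u (horner_alg x q) = horner_alg (u x) q.
  rewrite -[horner_alg x q]/((map_poly _ _).[_]) -horner_map -map_poly_comp.
  congr (_.[_]); apply: eq_map_poly => a /=.
  by rewrite linearZ /= rmorph1.
rewrite !E; congr (horner_alg _ _); rewrite !linear_sum; apply: eq_bigr => j _.
by rewrite !linearZ /= st.
Qed.

Lemma galvec_inj : injective galvec.
Proof.
move=> s t /rowP st; apply: gal_ext => j; have [c [y ->]] := alpha_rel j.
rewrite !rmorphD !rmorph_sum /=; congr (_ + _); last first.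
  by rewrite !linearZ /= !rmorph1.
apply: eq_bigr => k _; rewrite !raddfMn /= !gal_shiftE.
by have := st k; rewrite !mxE => ->.
Qed.

(** The combination [y] of the [alpha (e k)] with coefficients [v] is fixed by every automorphism,
    hence lies in K; then y^p - y is a combination of the [f (e k)], and [fe_free] forces the
    coefficients to vanish. *)
Lemma galvec_dual (v : 'rV['F_p]_r) :
  (forall s, \sum_k v 0 k * galvec s 0 k = 0) -> v = 0.
Proof.
move=> v0; pose y := \sum_k alpha (e k) *+ v 0 k.
have : y \in fixedField 'Gal({:L} / 1%AS)%g.
  apply/fixedFieldP; rewrite ?memvf // => s _.
  rewrite rmorph_sum /=; apply/eqP; rewrite -subr_eq0 -sumrB; apply/eqP.
  rewrite -[RHS](rmorph0 i_) -(v0 s) [RHS]rmorph_sum; apply: eq_bigr => k _.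
  rewrite raddfMn /= gal_shiftE -mulrnBl addrC addKr mulrn_Fpmor mulrC.
  by rewrite -[RHS]/(i_ _) mxE rmorphM.
rewrite (galois_fixedField galL) => /vlineP[a ya].
apply/rowP=> k; rewrite mxE; apply: (@fe_free (fun k => v 0 k) a).
apply: (fmorph_inj (in_alg L)).
have := AS_comb (fun k => v 0 k) 0 (fun k => alphaAS (e k)).
rewrite -/y scale0r addr0 expr0n (gtn_eqF (prime_gt0 p_pr)) subrr addr0.
by move=> /esym E; apply: etrans E _; rewrite ya rmorphB rmorphXn.
Qed.

(** By [galvec_dual] the vectors [galvec s] span. The image of [galvec] is closed under sums and
    multiples, hence under linear combinations over the prime field. *)
Lemma galvec_surj v : exists s, galvec s = v.
Proof.
pose M := \matrix_(i < #|{: gT}|) galvec (enum_val i).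
have : row_full M.
  rewrite /row_full -mxrank_tr -/(row_free M^T) -kermx_eq0; apply/negPn/negP.
  case/rowV0Pn=> u /sub_kermxP uM /negP[]; apply/eqP; apply: galvec_dual => s.
  have E := congr1 (fun A : 'rV_#|{: gT}| => A 0 (enum_rank s)) uM.
  rewrite [LHS]mxE [RHS]mxE in E; rewrite -[RHS]E; apply: eq_bigr => k _.
  by rewrite [in RHS]mxE [in RHS]mxE enum_rankK.
move=> Mfull; have /submxP[D ->] : (v <= M)%MS by apply: submx_full.
rewrite mulmx_sum_row; apply: (big_ind (fun v => exists s, galvec s = v)).
- by exists 1%g; rewrite (morph1 galvec_morphism).
- by move=> _ _ [s <-] [t <-]; exists (s * t)%g; rewrite galvecM ?inE.
- move=> i _; rewrite rowK; exists (enum_val i ^+ (D 0 i : nat))%g.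
  by rewrite (morphX galvec_morphism) ?inE //= -[D 0 i in RHS]natr_Zp
    scaler_nat.
Qed.

Lemma gal_isog : 'Gal({:L} / 1%VS)%g \isog [set: 'rV['F_p]_r].
Proof.
have galT : 'Gal({:L} / 1%AS)%g = [set: gT].
  by apply/setP=> s; rewrite inE gal_kHom ?sub1v //;
    apply/kAHomP=> x /vlineP[a ->];
     rewrite linearZ /= rmorph1.
rewrite galT; apply/isogP; exists galvec_morphism.
  by apply/injmP=> s t _ _; apply: galvec_inj.
apply/setP=> v; rewrite !inE; have [s <-] := galvec_surj v.
by rewrite mem_morphim ?inE.
Qed.

(** * Points of A in L *)

Local Notation w := (wdet p f (ASvar pK f)).
Local Notation ffT := {ffun 'I_m.+1 -> 'F_p}.

Lemma point_exists (c : ffT) : exists h : {lrmorphism A -> L},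
  forall k, h (ASvar pK f k) = alpha k + i_ (c k).
Proof.
apply: (@AS_universal K p pK m.+1 f L (fun k => alpha k + i_ (c k))) => k.
exact: AS_translate.
Qed.

Definition point (c : ffT) : {lrmorphism A -> L} := sval (cid (point_exists c)).

Lemma pointE c k : point c (ASvar pK f k) = alpha k + i_ (c k).
Proof. by rewrite /point; case: cid. Qed.

Lemma lrmorph_horner (B C : comAlgType K) (h : {lrmorphism B -> C}) x q :
  h (horner_alg x q) = horner_alg (h x) q.
Proof.
rewrite -[horner_alg x q]/((map_poly _ _).[_]) -horner_map -map_poly_comp.
congr (_.[_]); apply: eq_map_poly => a /=.
by rewrite linearZ /= rmorph1.
Qed.

Lemma point_w c : point c w = Qroot f alpha c.
Proof.
rewrite wdetE linear_sum; apply: eq_bigr => j _.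
by rewrite linearZ /= pointE.
Qed.

(** The points send [w] to p^(m+1) distinct elements of L, too many roots for a nonzero [q] of this
    size. *)
Lemma horner_w_small (q : {poly K}) : (size q <= p ^ m.+1)%N ->
  (forall c, point c (horner_alg w q) = 0) -> q = 0.
Proof.
move=> sq q0; apply/eqP; rewrite -(map_poly_eq0 (in_alg L));
  apply/negPn/negP => qn0.
have := @max_poly_roots _ _ [seq Qroot f alpha c | c : ffT] qn0.
rewrite size_map_poly size_map -cardT card_ffun card_Fp // card_ord ltnNge sq.
move=> H; suff: false by []; apply: H.
  apply/allP=> _ /mapP[c _ ->]; rewrite rootE -point_w.
  by apply/eqP; have := q0 c; rewrite lrmorph_horner.
by rewrite map_inj_uniq ?enum_uniq //; apply: (Qroot_inj pK f_indep).
Qed.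

(** An element of A is a polynomial in [w], which may be reduced modulo Q to the size allowed by
    [horner_w_small]. *)
Lemma point_sep (x : A) : (forall c, point c x = 0) -> x = 0.
Proof.
have [q ->] := AS_horner f_indep x => q0.
have [mQ sQ] := (monic_Qpoly pK f_indep, size_Qpoly pK f_indep).
have E : horner_alg w q = horner_alg w (q %% Qpoly p f).
  rewrite {1}(divp_eq q (Qpoly p f)) rmorphD rmorphM /= wdet_root // mulr0.
  by rewrite add0r.
rewrite E (@horner_w_small (q %% Qpoly p f)) ?rmorph0 //.
  by rewrite -ltnS -sQ ltn_modp monic_neq0.
by move=> c; rewrite -E.
Qed.

Lemma theta_exists : exists theta : {lrmorphism {poly %/ (Qpoly p f)} -> A},
  bijective theta /\ theta 'qX = w.
Proof.
have [mQ sQ] := (monic_Qpoly pK f_indep, size_Qpoly pK f_indep).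
have sQ1 : (1 < size (Qpoly p f))%N by rewrite sQ ltnS expn_gt0 prime_gt0.
have mkQ : mk_monic (Qpoly p f) = Qpoly p f by rewrite /mk_monic sQ1 mQ.
pose th (q : {poly %/ (Qpoly p f)}) : A := horner_alg w (q : {poly K}).
have th_in q : th (in_qpoly (Qpoly p f) q) = horner_alg w q.
  rewrite /th /= mkQ -Pdiv.IdomainMonic.modpE //.
  rewrite {2}(divp_eq q (Qpoly p f)) rmorphD rmorphM /= wdet_root // mulr0.
  by rewrite add0r.
have th_add : zmod_morphism th by move=> a b; rewrite /th -rmorphB.
have th_mul : monoid_morphism th.
  split=> [|a b]; first by rewrite /th -[RHS](rmorph1 (horner_alg w)).
  by rewrite [a * b]/(in_qpoly _ _) th_in rmorphM.
have th_sc : scalable th.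
  move=> a q; rewrite -[LHS]/(horner_alg w (a *: (q : {poly K}))) linearZ /=.
  by rewrite mulr_algl.
pose M1 := GRing.isZmodMorphism.Build _ _ th th_add.
pose M2 := GRing.isMonoidMorphism.Build _ _ th th_mul.
pose M3 := GRing.isScalable.Build K _ A *:%R th th_sc.
pose theta : {lrmorphism {poly %/ (Qpoly p f)} -> A} := HB.pack th M1 M2 M3.
exists theta; split; last by rewrite -[LHS]/(th _) th_in horner_algX.
have inj : injective theta.
  move=> a b /eqP; rewrite -subr_eq0 -rmorphB => /eqP ab0.
  apply/eqP; rewrite -subr_eq0; apply/eqP/val_inj => /=.
  apply: (@horner_w_small _).
    have := size_mk_monic (a - b); rewrite {2}mkQ sQ ltnS; exact.
  by move=> c; rewrite -[horner_alg _ _]/(theta (a - b)) ab0 rmorph0.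
have surj x : exists q, x = theta q.
  have [q ->] := AS_horner f_indep x; exists (in_qpoly (Qpoly p f) q).
  by rewrite -[RHS]/(th _) th_in.
have /choice[g gE] := surj.
by exists g => x; [apply: inj; rewrite -gE|rewrite -gE].
Qed.

(** * Splitting of A *)

Variable J : {set 'I_m.+1}.
Hypothesis e_notinJ : forall k, e k \notin J.
Hypothesis e_cover : forall j, j \notin J -> exists k, e k = j.

(** Vectors supported on [J] are to index the Galois orbits of points: the Galois group translates
    the remaining coordinates simply transitively. *)
Lemma Jpoints_enum : exists b : 'I_(p ^ #|J|) -> ffT,
  [/\ injective b, forall i j, j \notin J -> b i j = 0
    & forall c : ffT, (forall j, j \notin J -> c j = 0) -> exists i, b i = c].
Proof.
pose S := [set c : ffT | c \in pffun_on (0 : 'F_p) (mem J) predT].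
have SE (c : ffT) : reflect (forall j, j \notin J -> c j = 0) (c \in S).
  rewrite inE; apply: (iffP pffun_onP) => [[sc _] j|c0].
    by apply: contraNeq => cj; apply: (subsetP sc).
  split=> //; apply/subsetP=> j; apply: contraLR => /c0 cj.
  by rewrite supportE cj eqxx.
have cS : #|S| = (p ^ #|J|)%N by rewrite cardsE card_pffun_on cardT /= -cardT
  card_Fp.
exists (fun i => enum_val (cast_ord (esym cS) i)); split.
- by move=> i j /enum_val_inj /cast_ord_inj.
- by move=> i j jJ; move: (enum_valP (cast_ord (esym cS) i)) => /SE; apply.
- move=> c /SE cS'; exists (cast_ord cS (enum_rank_in cS' c)).
  by rewrite cast_ordK enum_rankK_in.
Qed.

Section ProductMap.
Variables (N : nat) (b : 'I_N -> ffT).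
Hypothesis b_inj : injective b.
Hypothesis b_J : forall i j, j \notin J -> b i j = 0.
Hypothesis b_onto :
  forall c : ffT, (forall j, j \notin J -> c j = 0) -> exists i, b i = c.

Definition prodmap (x : A) : {ffun 'I_N -> L} := [ffun i => point (b i) x].

Fact prodmap_zmod_morphism : zmod_morphism prodmap.
Proof. by move=> x y; apply/ffunP=> i; rewrite !ffunE rmorphB. Qed.

Fact prodmap_monoid_morphism : monoid_morphism prodmap.
Proof.
by split=> [|x y]; apply/ffunP=> i; rewrite !ffunE ?rmorph1 ?rmorphM.
Qed.

Fact prodmap_scalable : scalable prodmap.
Proof. by move=> a x; apply/ffunP=> i; rewrite !ffunE linearZ. Qed.

HB.instance Definition _ := GRing.isZmodMorphism.Build A {ffun 'I_N -> L}
  prodmap prodmap_zmod_morphism.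
HB.instance Definition _ := GRing.isMonoidMorphism.Build A {ffun 'I_N -> L}
  prodmap prodmap_monoid_morphism.
HB.instance Definition _ := GRing.isScalable.Build K A {ffun 'I_N -> L} *:%R
  prodmap prodmap_scalable.

(** The Galois group acts on the points by translating their coordinates. *)
Let gal_point (s : gT) (c : ffT) x :
  s (point c x) = point [ffun j => c j + gal_shift s j] x.
Proof.
have hS : scalable (fun y => s (point c y)).
  by move=> a y; rewrite linearZ /= linearZ.
have hA : zmod_morphism (fun y => s (point c y)).
  by move=> y z; rewrite !rmorphB.
have hM : monoid_morphism (fun y => s (point c y)).
  by split=> [|y z]; rewrite ?rmorph1 // !rmorphM.
pose M1 := GRing.isZmodMorphism.Build _ _ _ hA.
pose M2 := GRing.isMonoidMorphism.Build _ _ _ hM.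
pose M3 := GRing.isScalable.Build K A L *:%R _ hS.
pose h : {lrmorphism A -> L} := HB.pack (fun y => s (point c y)) M1 M2 M3.
apply: (@AS_hom_ext _ _ _ _ _ L h) => k; rewrite -[h _]/(s (point c _)) !pointE.
rewrite rmorphD /= gal_i gal_shiftE ffunE rmorphD /=.
by rewrite -addrA [i_ (gal_shift s k) + _]addrC.
Qed.

Lemma prodmap_inj : injective prodmap.
Proof.
move=> x y /eqP; rewrite -subr_eq0 -rmorphB => /eqP xy0.
apply/eqP; rewrite -subr_eq0; apply/eqP; move: {x y}(x - y) xy0 => x x0.
apply: point_sep => c.
(* This [s] has the coordinates of [c] outside [J]; subtracting its shift leaves a vector supported
   on [J], so every point is conjugate to some [point (b i)]. *)
have [s sE] := galvec_surj (\row_k c (e k)).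
have [|i iE] := b_onto (c := [ffun j => c j - gal_shift s j]).
  move=> j /e_cover[k <-]; have := congr1 (fun v : 'rV_r => v 0 k) sE.
  by rewrite !mxE ffunE => ->; rewrite subrr.
have -> : c = [ffun j => b i j + gal_shift s j].
  by apply/ffunP=> j; rewrite ffunE iE ffunE subrK.
rewrite -gal_point.
by have := congr1 (fun F : {ffun 'I_N -> L} => F i) x0; rewrite !ffunE => ->;
  rewrite rmorph0.
Qed.

(** The values whose constant tuples lie in the image of [prodmap]; they form a K-subalgebra of
    L. *)
Let const (y : L) := exists x, forall i, point (b i) x = y.

Let const_alg a : const a%:A.
Proof. by exists a%:A => i; rewrite linearZ /= rmorph1. Qed.
Let constD y z : const y -> const z -> const (y + z).
Proof. by case=> x xE [x' xE']; exists (x + x') => i;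
  rewrite rmorphD /= xE xE'. Qed.
Let constM y z : const y -> const z -> const (y * z).
Proof. by case=> x xE [x' xE']; exists (x * x') => i;
  rewrite rmorphM /= xE xE'. Qed.

Lemma alpha_subalg (S : L -> Prop) :
  (forall a : K, S a%:A) -> (forall y z, S y -> S z -> S (y + z)) ->
  (forall y z, S y -> S z -> S (y * z)) -> (forall k, S (alpha (e k))) ->
  forall y, S y.
Proof.
move=> S1 SD SM Se y.
have Sj j : S (alpha j).
  have [c [a ->]] := alpha_rel j; apply: (SD _ _) => //; apply: (big_ind S).
  - by rewrite -(scale0r 1).
  - exact: SD.
  by move=> k _; rewrite mulrn_Fpmor; apply: (SM _ _) => //;
     rewrite /Fpmor -(rmorph_nat (in_alg L)); apply: S1.
have [q ->] := alpha_gen y; elim/poly_ind: q => [|q a IHq].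
  by rewrite rmorph0 -(scale0r 1).
rewrite rmorphD rmorphM /= horner_algX horner_algC; apply: (SD _ _) => //;
  apply: (SM _ _) => //.
apply: (big_ind S); [by rewrite -(scale0r 1)|exact: SD|].
by move=> j _; rewrite -mulr_algl; apply: SM.
Qed.

(** The generators [alpha (e k)] of L qualify: since [b i] vanishes outside [J], every [point (b i)]
    sends w_(e k) to [alpha (e k)]. *)
Lemma const_all y : const y.
Proof.
apply: alpha_subalg => // k; exists (ASvar pK f (e k)) => i.
by rewrite pointE b_J // rmorph0 addr0.
Qed.

Lemma coord_exists j : exists x : A, forall i, point (b i) x = i_ (b i j).
Proof.
have [x xE] := const_all (alpha j); exists (ASvar pK f j - x) => i.
by rewrite rmorphB /= xE pointE addrC addKr.
Qed.

(* [1 - (t - t0)^(p-1)] is the indicator of t0 on F_p. *)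
Lemma delta_exists i0 : exists x : A, forall i, point (b i) x = (i == i0)%:R.
Proof.
have /choice[X XE] := coord_exists.
exists (\prod_j (1 - (X j - (b i0 j : nat)%:R) ^+ p.-1)) => i.
have E j : point (b i) (1 - (X j - (b i0 j : nat)%:R) ^+ p.-1) =
  (b i j == b i0 j)%:R.
  rewrite rmorphB rmorph1 rmorphXn rmorphB /= XE rmorph_nat -/(Fpmor pL (b i0
    j)).
  rewrite -rmorphB -(inj_eq (@addIr _ (- b i0 j))) subrr /=.
  have p1 : p.-1 = (p.-2).+1 by have := prime_gt1 p_pr; lia.
  case: eqVneq => [->|u0]; first by rewrite rmorph0 p1 exprS mul0r subr0.
  have un0 : i_ (b i j - b i0 j) != 0 by rewrite fmorph_eq0.
  suff -> : i_ (b i j - b i0 j) ^+ p.-1 = 1 by rewrite subrr.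
  by apply: (mulIf un0); rewrite -exprSr prednK ?prime_gt0 // mul1r natrFpX.
rewrite rmorph_prod /=; under eq_bigr do rewrite E.
case: eqVneq => [->|ii0]; first by rewrite big1 // => j _; rewrite eqxx.
have [j jE] : exists j, b i j != b i0 j.
  apply/existsP; apply: contraR ii0 => /existsPn H; apply/eqP/b_inj/ffunP => j.
  by apply/eqP/negPn/H.
by rewrite (bigD1 j) //= (negPf jE) mul0r.
Qed.

(** Preimages of the primitive idempotents are multiplied by preimages of constant tuples and
    summed. *)
Lemma prodmap_surj F : exists x, F = prodmap x.
Proof.
have /choice[D DE] := delta_exists.
have /choice[C CE] := const_all.
exists (\sum_i D i * C (F i)); apply/ffunP=> i.
rewrite ffunE rmorph_sum (bigD1 i) //= rmorphM /= DE CE eqxx mul1r big1 ?addr0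
  //.
by move=> k /negPf ki; rewrite rmorphM /= DE eq_sym ki mul0r.
Qed.

Lemma prodmap_bij : bijective prodmap.
Proof.
have /choice[g gE] := prodmap_surj.
by exists g => x; [apply: prodmap_inj; rewrite -gE|rewrite -gE].
Qed.

(** Injectivity comes from A: [incl] embeds [AI] in A, with retraction [rho], and every
    [point (b i)] restricts to [psi] on [AI], so [prodmap_inj] applies. *)
Lemma psi_exists : exists psi : {lrmorphism AI -> L}, bijective psi.
Proof.
have [psi psiE] := @AS_universal _ _ pK _ (fun k => f (e k)) L _ (fun k =>
  alphaAS (e k)).
exists psi.
have [incl inclE] := @AS_universal _ _ pK _ (fun k => f (e k)) A _ (fun k =>
  ASvarE pK f (e k)).
(* To define [rho], each equation is solved in [AI]: by its own variable outside [J], and by the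
   combination of [fe_span] on [J]. *)
have /choice[g gE] : forall j, exists g : AI, g ^+ p - g = (f j)%:A /\
    forall k, e k = j -> g = ASvar pK (fun k => f (e k)) k.
  move=> j; case: (boolP (j \in J)) => [jJ|/e_cover[k <-]]; last first.
    by exists (ASvar pK (fun k => f (e k)) k); split=> [|k' /e_inj -> //];
      apply: (ASvarE pK (fun k => f (e k))).
  have [c [y fj]] := fe_span j.
  exists (\sum_k ASvar pK (fun k => f (e k)) k *+ c k + y%:A); split.
    rewrite fj; apply: AS_comb => k; exact: (ASvarE pK (fun k => f (e k))).
  by move=> k kj; have := e_notinJ k; rewrite kj jJ.
have [rho rhoE] := AS_universal pK (fun j => proj1 (gE j)).
have rhoK x : rho (incl x) = x.
  apply: (@AS_hom_ext _ _ _ _ _ AI (rho \o incl) idfun) => k /=.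
  by rewrite inclE rhoE; apply: (proj2 (gE (e k))).
have inj : injective psi.
  move=> x y xy; rewrite -[x]rhoK -[y]rhoK; congr (rho _); apply: prodmap_inj.
  have E i z : point (b i) (incl z) = psi z.
    apply: (@AS_hom_ext _ _ _ _ _ L (point (b i) \o incl) psi) => k /=.
    by rewrite inclE pointE psiE b_J // rmorph0 addr0.
  by apply/ffunP=> i; rewrite !ffunE !E xy.
have surj y : exists x, y = psi x.
  apply: (alpha_subalg (S := fun y => exists x, y = psi x)) => [a|||k].
  - by exists a%:A; rewrite linearZ /= rmorph1.
  - by move=> _ _ [u ->] [v ->]; exists (u + v); rewrite rmorphD.
  - by move=> _ _ [u ->] [v ->]; exists (u * v); rewrite rmorphM.
  - by exists (ASvar pK (fun k => f (e k)) k); rewrite psiE.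
have /choice[h hE] := surj.
by exists h => x; [apply: inj; rewrite -hE|rewrite -hE].
Qed.

End ProductMap.

End Structure.

(** * The symmetric group acting on tuples *)

Section PermutationAction.
Variables (vT : finGroupType) (N : nat).

(** The inverse makes this a right action, the product [a * b] of permutations applying [a]
    first. *)
Definition permute_fun (x : {dffun forall i : 'I_N, vT}) (a : 'S_N) :
  {dffun forall i : 'I_N, vT} := [ffun i => x ((a^-1)%g i)].

Fact permute_fun1 : permute_fun^~ 1%g =1 id.
Proof. by move=> x; apply/ffunP=> i; rewrite ffunE invg1 perm1. Qed.

Fact permute_funM x : act_morph permute_fun x.
Proof. by move=> a b; apply/ffunP=> i; rewrite !ffunE invMg permM. Qed.

Definition permute_action := TotalAction permute_fun1 permute_funM.

Fact permute_is_groupAction :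
  is_groupAction [set: {dffun forall i : 'I_N, vT}] permute_action.
Proof.
move=> a _; rewrite inE; apply/andP; split; first by apply/subsetP=> x;
  rewrite inE.
apply/morphicP=> x y _ _; rewrite !actpermE.
by apply/ffunP=> i; rewrite !ffunE.
Qed.

Definition permute_groupAction := GroupAction permute_is_groupAction.

End PermutationAction.

(** * Automorphisms of a product of copies of L *)

Section AutProduct.
Variables (K : fieldType) (A : comAlgType K) (L : splittingFieldType K).
Variables (N : nat) (phi : {lrmorphism A -> {ffun 'I_N -> L}}).
Variable phi' : {ffun 'I_N -> L} -> A.
Hypotheses (phiK : cancel phi phi') (phi'K : cancel phi' phi).
Hypothesis galL : galois 1%VS {:L}.
Local Notation gT := (gal_of {:L}).
Variables (vT : finGroupType) (sigma : vT -> gT).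
Hypothesis sigmaM : forall u v y, sigma (u * v)%g y = sigma u (sigma v y).
Hypothesis sigma_inj : injective sigma.
Hypothesis sigma_onto : forall s : gT, exists v, sigma v = s.

Let phi_inj : injective phi := can_inj phiK.
Local Notation G := (sdprod_by (permute_groupAction vT N)).

(** The twist is read at [u.1 i], not at [i], in accordance with the product of [sdprod_by], which
    permutes the left tuple by the right permutation. *)
Definition wreath (u : G) (F : {ffun 'I_N -> L}) : {ffun 'I_N -> L} :=
  [ffun i => sigma (u.2 (u.1 i)) (F (u.1 i))].

Lemma wreathM u v F : wreath (u * v)%g F = wreath u (wreath v F).
Proof.
apply/ffunP=> i; rewrite !ffunE /= permM.
by rewrite -sigmaM permK.
Qed.

Lemma wreath1 F : wreath 1%g F = F.
Proof.
apply/ffunP=> i; rewrite ffunE /= perm1.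
have -> : sigma ((1%g : {dffun forall i : 'I_N, vT}) i) = 1%g.
  have [v vE] := sigma_onto 1%g; rewrite ffunE.
  apply/eqP/gal_eqP => y _; rewrite gal_id.
  have : sigma (v * 1)%g y = y by rewrite mulg1 vE gal_id.
  by rewrite sigmaM vE gal_id.
by rewrite gal_id.
Qed.

Definition wreath_conj (u : G) (x : A) : A := phi' (wreath u (phi x)).

Fact wreath_conj_zmod_morphism u : zmod_morphism (wreath_conj u).
Proof.
move=> x y; apply: phi_inj; rewrite rmorphB /= !phi'K.
by apply/ffunP=> i; rewrite !ffunE !rmorphB /= !ffunE rmorphB.
Qed.

Fact wreath_conj_monoid_morphism u : monoid_morphism (wreath_conj u).
Proof.
split=> [|x y]; apply: phi_inj; rewrite ?rmorphM ?rmorph1 /= !phi'K;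
  apply/ffunP=> i; rewrite !ffunE ?rmorph1 ?ffunE ?rmorph1 //.
by rewrite !rmorphM /= !ffunE rmorphM.
Qed.

Fact wreath_conj_scalable u : scalable (wreath_conj u).
Proof.
move=> a x; apply: phi_inj; rewrite linearZ /= !phi'K.
by apply/ffunP=> i; rewrite !ffunE linearZ /= !ffunE linearZ.
Qed.

HB.instance Definition _ u := GRing.isZmodMorphism.Build A A
  (wreath_conj u) (wreath_conj_zmod_morphism u).
HB.instance Definition _ u := GRing.isMonoidMorphism.Build A A
  (wreath_conj u) (wreath_conj_monoid_morphism u).
HB.instance Definition _ u := GRing.isScalable.Build K A A *:%R
  (wreath_conj u) (wreath_conj_scalable u).

Let delta (k : 'I_N) : {ffun 'I_N -> L} := [ffun i => (i == k)%:R].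

(** The primitive idempotents detect the permutation, and the constant tuples then detect the
    twists. *)
Lemma wreath_inj u v : wreath u =1 wreath v -> u = v.
Proof.
move=> uv; have u1 : u.1 = v.1.
  apply/permP=> i; have :=
    congr1 (fun F : {ffun 'I_N -> L} => F i) (uv (delta (v.1 i))).
  rewrite !ffunE eqxx rmorph1 rmorph_nat; case: eqP => // _ /eqP.
  by rewrite eq_sym oner_eq0.
apply/val_inj; rewrite [val u]surjective_pairing [val v]surjective_pairing.
congr (_, _) => //; apply/ffunP=> i; apply: sigma_inj; apply/eqP/gal_eqP => y _.
have := congr1 (fun F : {ffun 'I_N -> L} => F ((u.1^-1)%g i)) (uv [ffun=> y]).
by rewrite !ffunE -u1 permKV.
Qed.

(* A K-automorphism of L^N permutes the N primitive idempotents. *)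
Lemma wreath_onto (h : {lrmorphism A -> A}) : bijective h ->
  exists u, wreath_conj u =1 h.
Proof.
case=> h' hK h'K; pose H F := phi (h (phi' F)).
have H_inj : injective H by move=> F F' /phi_inj /(can_inj hK) /(can_inj phi'K).
have phi'E F x : phi x = F -> phi' F = x by move=> <-.
have HB F F' : H (F - F') = H F - H F'.
  by rewrite /H -!rmorphB; congr (phi (h _)); apply: phi'E;
    rewrite rmorphB /= !phi'K.
have HM F F' : H (F * F') = H F * H F'.
  by rewrite /H -!rmorphM; congr (phi (h _)); apply: phi'E;
    rewrite rmorphM /= !phi'K.
have H1 : H 1 = 1 by rewrite /H (phi'E _ 1) ?rmorph1.
have HZ a F : H (a *: F) = a *: H F.
  by rewrite /H -!linearZ; congr (phi (h _)); apply: phi'E;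
    rewrite linearZ /= !phi'K.
have H0 : H 0 = 0 by have := HB 0 0; rewrite !subrr.
have HN F : H (- F) = - H F by rewrite -sub0r HB H0 sub0r.
have HD F F' : H (F + F') = H F + H F' by rewrite -{1}[F']opprK HB HN opprK.
(* The images of the primitive idempotents are orthogonal idempotents of sum 1 in L^N, so each
   coordinate [i] sees exactly one of them, of index [t i]. *)
have H01 k i : (H (delta k) i == 0) || (H (delta k) i == 1).
  rewrite -[X in _ || X]subr_eq0 -mulf_eq0 mulrBr mulr1 subr_eq0.
  have E : delta k * delta k = delta k.
    by apply/ffunP=> l; rewrite !ffunE; case: eqP; rewrite ?mulr1 ?mulr0.
  by have := congr1 (fun F : {ffun 'I_N -> L} => F i) (HM (delta k) (delta k));
    rewrite E ffunE => <-.
have Hne k k' i : k != k' -> H (delta k) i = 1 -> H (delta k') i = 0.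
  move=> kk' h1; have E : delta k * delta k' = 0.
    apply/ffunP=> l; rewrite !ffunE; case: eqP => [->|_]; last by rewrite mul0r.
    by rewrite (negPf kk') mulr0.
  have := congr1 (fun F : {ffun 'I_N -> L} => F i) (HM (delta k) (delta k')).
  by rewrite E H0 !ffunE h1 mul1r.
have /choice[t tE] : forall i, exists k, H (delta k) i = 1.
  move=> i; case: (pselect (exists k, H (delta k) i = 1)) => // nk.
  have : (H 1 : {ffun 'I_N -> L}) i = 0.
    have -> : 1 = \sum_k delta k.
      apply/ffunP=> l; rewrite sum_ffunE !ffunE (bigD1 l) //= ffunE eqxx big1
        ?addr0 //.
      by move=> k /negPf kl; rewrite ffunE eq_sym kl.
    rewrite (big_morph H HD H0) sum_ffunE big1 // => k _.
    by have := H01 k i => /orP[/eqP //|/eqP hk]; case: nk; exists k.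
  by rewrite H1 ffunE => /eqP; rewrite oner_eq0.
have /choice[u uE] : forall k, exists i, t i = k.
  move=> k; have [i hi] : exists i, H (delta k) i != 0.
    apply/existsP; apply: contraTT isT => /existsPn Hk.
    have : delta k = 0.
      by apply: H_inj; rewrite H0; apply/ffunP=> i; rewrite ffunE;
        apply/eqP/negPn/Hk.
    by move/ffunP/(_ k); rewrite !ffunE eqxx => /eqP; rewrite oner_eq0.
  exists i; apply/eqP; apply: contraNT hi => tk.
  by apply/eqP/(Hne (t i)).
have t_inj : injective t := can_inj (canF_sym uE).
pose tau i (y : L) : L := H [ffun=> y] i.
(* Multiplying by [delta (t i)], whose image is 1 at [i], shows that this coordinate depends only on
   [F (t i)]. *)
have HE F i : H F i = tau i (F (t i)).
  have E1 : H F i = H (F * delta (t i)) i by rewrite HM ffunE tE mulr1.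
  have E2 : tau i (F (t i)) = H ([ffun=> F (t i)] * delta (t i)) i.
    by rewrite HM ffunE tE mulr1.
  rewrite E1 E2; congr (H _ i); apply/ffunP=> l; rewrite !ffunE.
  by case: eqP => [->|_]; rewrite ?mulr0.
have /choice[v vE] : forall i, exists v, forall y, sigma v y = tau i y.
  move=> i.
  have tB : zmod_morphism (tau i).
    move=> y z; rewrite /tau (_ : [ffun=> y - z] =
      [ffun=> y] - [ffun=> z]) ?HB ?ffunE //.
    by apply/ffunP=> l; rewrite !ffunE.
  have tM : monoid_morphism (tau i).
    split=> [|y z]; rewrite /tau.
      by rewrite (_ : [ffun=> 1] = 1) ?H1 ?ffunE //; apply/ffunP=> l;
        rewrite !ffunE.
    rewrite (_ : [ffun=> y * z] = [ffun=> y] * [ffun=> z]) ?HM ?ffunE //.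
    by apply/ffunP=> l; rewrite !ffunE.
  have tZ : scalable (tau i).
    move=> a y; rewrite /tau (_ : [ffun=> a *: y] =
      a *: [ffun=> y]) ?HZ ?ffunE //.
    by apply/ffunP=> l; rewrite !ffunE.
  pose M1 := GRing.isZmodMorphism.Build _ _ _ tB.
  pose M2 := GRing.isMonoidMorphism.Build _ _ _ tM.
  pose M3 := GRing.isScalable.Build K L L *:%R _ tZ.
  pose T : {lrmorphism L -> L} := HB.pack (tau i) M1 M2 M3.
  have homT : kHom 1 {:L} (linfun T).
    apply/kHomP; split=> [x y _ _|x /vlineP[a ->]].
      by rewrite !lfunE; apply: tM.2.
    by rewrite lfunE; apply: etrans (tZ a 1) _; rewrite tM.1.
  have subL : (1%AS <= {:L}%AS <= {:L}%AS)%VS by rewrite sub1v subvv.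
  have /and3P[_ _ normL] := galL.
  have [s _ sE] := kHom_to_gal subL normL homT.
  have [v vs] := sigma_onto s; exists v => y.
  by rewrite vs -sE ?memvf // lfunE.
(* As [wreath] reads the twist at [t i], the tuple is reindexed by the inverse [u] of [t]. *)
have uP : (perm t_inj, [ffun j => v (u j)] : {dffun forall i : 'I_N, vT})
    \in setX [set: 'S_N] [set: {dffun forall i : 'I_N, vT}] by rewrite !inE.
exists (SdPair (permute_groupAction vT N) uP) => x; apply: phi_inj.
rewrite phi'K; apply/ffunP=> i; rewrite !ffunE /= permE vE.
by rewrite (canF_sym uE) -HE /H phiK.
Qed.

Lemma Aut_product : Aut_isog A G.
Proof.
have PM u v : wreath_conj (u * v)%g =1 wreath_conj u \o wreath_conj v.
  by move=> x; rewrite /wreath_conj /= wreathM phi'K.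
have P1 : wreath_conj 1%g =1 id by move=> x; rewrite /wreath_conj wreath1 phiK.
exists wreath_conj; split.
- move=> u; exists (wreath_conj u^-1%g) => x.
    by rewrite -[LHS]PM mulVg P1.
  by rewrite -[LHS]PM mulgV P1.
- exact: PM.
- move=> u v uv; apply: wreath_inj => F.
  by have /(can_inj phi'K) := uv (phi' F); rewrite phi'K.
- exact: wreath_onto.
Qed.

End AutProduct.

(** * Bases of V and relations modulo (F - Id)(K) *)

Section CokernelBasis.
Variables (K : fieldType) (p : nat) (pK : p \in [pchar K]).
Local Notation cls := (AScls pK).
Let p_pr : prime p := pcharf_prime pK.

Fact AScls_zmod_morphism : zmod_morphism cls.
Proof. by move=> x y; rewrite /AScls raddfB. Qed.
HB.instance Definition _ :=
  GRing.isZmodMorphism.Build K (AScoker pK) cls AScls_zmod_morphism.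

Lemma AScls_eq0 x : cls x = 0 <-> exists y, x = y ^+ p - y.
Proof.
rewrite -(raddf0 cls) /AScls; split=> [/eqP|H].
  by rewrite -Quotient.idealrBE subr0 => /asboolP.
by apply/eqP; rewrite -Quotient.idealrBE subr0; apply/asboolP.
Qed.

Lemma AScoker_mulrn (v : AScoker pK) : v *+ p = 0.
Proof.
have -> : v = cls (repr v) by rewrite /AScls reprK.
by rewrite -raddfMn /= mulrn_pchar ?raddf0.
Qed.

Section Basis.
Variables (n : nat) (f : 'I_n -> K).

Lemma ASspace_comb m (v : 'I_m -> AScoker pK) (c : 'I_m -> nat) :
  (forall k, ASspace f (v k)) -> ASspace f (\sum_k v k *+ c k).
Proof.
have S0 : ASspace f (0 : AScoker pK).
  exists (fun _ => 0), 0; apply/esym/AScls_eq0; exists 0.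
  by rewrite big1 ?add0r // => i _; rewrite mulr0n.
have SD u u' : ASspace f u -> ASspace f u' -> ASspace f (u + u' : AScoker pK).
  case=> [a [y ->]] [a' [y' ->]]; exists (fun i => a i + a' i), (y + y').
  rewrite -raddfD; congr cls; rewrite addrACA; congr (_ + _).
    rewrite -big_split; apply: eq_bigr => i _ /=.
    by rewrite (mulrnFpD p_pr _ _ (mulrn_pchar pK _)).
  have := rmorphD (frob pK 1) y y'; rewrite /= !frobE !expn1 => ->.
  by rewrite opprD addrACA.
move=> Sv; apply: (big_ind (fun u : AScoker pK => ASspace f u));
  [exact: S0|exact: SD|].
move=> k _; elim: (c k) => [|i IHi]; first by rewrite mulr0n.
by rewrite mulrS; apply: SD.
Qed.

Lemma ASbasis_inj m (v : 'I_m -> AScoker pK) : ASbasis f v ->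
  injective (fun c : {ffun 'I_m -> 'F_p} => \sum_k v k *+ c k).
Proof.
case=> _ v_free _ c c' cc'; apply/ffunP=> k; apply/eqP; rewrite -subr_eq0;
  apply/eqP.
apply: (v_free (fun k => c k - c' k)).
under eq_bigr do rewrite (mulrnFpB p_pr _ _ (AScoker_mulrn _)).
by rewrite sumrB cc' subrr.
Qed.

(** Dimension by counting: rewriting combinations of [v] in terms of [v'] injects a set of p^m
    coefficient vectors into one of p^m'. *)
Lemma ASbasis_leq m m' (v : 'I_m -> AScoker pK) (v' : 'I_m' -> AScoker pK) :
  ASbasis f v -> ASbasis f v' -> (m <= m')%N.
Proof.
move=> bv [_ _ v'_span]; have [Sv _ _] := bv.
have /choice[h hE] : forall c : {ffun 'I_m -> 'F_p},
    exists c' : {ffun 'I_m' -> 'F_p}, \sum_k v k *+ c k = \sum_k v' k *+ c' k.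
  move=> c; have [c' ->] := v'_span _ (ASspace_comb (fun k => c k : nat) Sv).
  by exists (finfun c'); apply: eq_bigr => k _; rewrite ffunE.
have h_inj : injective h.
  by move=> c c' cc'; apply: (ASbasis_inj bv); rewrite !hE cc'.
have := leq_card h h_inj; rewrite !card_ffun !card_ord Fp_cast //.
by rewrite leq_exp2l ?prime_gt1.
Qed.

Variables (m : nat) (e : 'I_m -> 'I_n).
Hypothesis basis_e : ASbasis f (fun k => cls (f (e k))).

(** This lemma and [basis_span] pull independence and generation in the quotient back to relations
    in K. *)
Lemma basis_free (c : 'I_m -> 'F_p) (y : K) :
  \sum_k f (e k) *+ c k = y ^+ p - y -> forall k, c k = 0.
Proof.
have [_ free _] := basis_e => cy; apply: free.
have -> : \sum_k cls (f (e k)) *+ c k = cls (\sum_k f (e k) *+ c k).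
  by rewrite raddf_sum; apply: eq_bigr => k _; rewrite raddfMn.
by apply/AScls_eq0; exists y.
Qed.

Lemma basis_span j : exists (c : 'I_m -> 'F_p) (y : K),
  f j = \sum_k f (e k) *+ c k + (y ^+ p - y).
Proof.
have [_ _ span] := basis_e.
have [|c cE] := span (cls (f j)).
  exists (fun i => (i == j)%:R), 0; congr cls.
  rewrite expr0n (gtn_eqF (prime_gt0 p_pr)) subrr addr0.
  by rewrite (bigD1 j) //= eqxx big1 ?addr0 // => i /negPf ->.
have : cls (f j - \sum_k f (e k) *+ c k) = 0.
  rewrite raddfB /= cE raddf_sum -sumrB big1 // => k _.
  by rewrite raddfMn subrr.
by case/AScls_eq0=> y yE; exists c, y; rewrite -yE addrC subrK.
Qed.

End Basis.
End CokernelBasis.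

(** * The displayed form of Q and the assembly of the results *)

Lemma Qpoly_explicit (K : fieldType) (p : nat) (pK : p \in [pchar K]) (m : nat)
    (f : 'I_m.+1 -> K) (Delta := moore p f) : Delta != 0 ->
  Qpoly p f = 'X^(p ^ m.+1)
    + \sum_(1 <= i < m.+1)
        ((-1) ^+ (m.+1 - i)
         * Delta ^ ((p ^ m)%:Z - (p ^ i.-1)%:Z - (p ^ i)%:Z)
         * moore_omit p (m.+1 - i) f ^+ (p ^ i.-1)) *: 'X^(p ^ i)
    + ((-1) ^+ m.+1 * Delta ^+ (p ^ m - 1)) *: 'X
    - (Delta ^+ (p ^ m))%:P.
Proof.
move=> D0; have p_pr := pcharf_prime pK.
rewrite (QpolyE pK); congr (_ - _).
rewrite big_ord_recl big_ord_recr /= [RHS]addrC; congr (_ + _).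
  have := qexpl_qcoef pK D0 ord0; rewrite /= => <-.
  rewrite expn0 expr1; congr (_ * _ *: _).
  by rewrite frobE -{1}(subnK (_ : 1 <= p ^ m)%N) ?expn_gt0 ?prime_gt0 // addn1
    exprSr mulfK.
rewrite [RHS]addrC big_add1 big_mkord; congr (_ + _); last first.
  by rewrite /bump add1n (qcoef_max pK) ?scale1r.
apply: eq_bigr => i _; rewrite /bump /= add1n; congr (_ *: _).
have im : (i.+1 < m.+2)%N by rewrite !ltnS ltnW.
rewrite -(qexpl_qcoef pK D0 (Ordinal im)) /= subSS; congr (_ * _ * _).
(* Integer powers split into quotients; the exponent is negative for the largest index of the
   sum. *)
by rewrite !expfzDr // -!exprnP -!exprnN -mulrA -invfM.
Qed.

Theorem proposition5p2 (K : fieldType) (p : nat) (pK : p \in [pchar K])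
    (Kalg : closedFieldType) (iota : {rmorphism K -> Kalg})
    (Kalg_algebraic : forall x : Kalg, algebraicOver iota x)
    (n : nat) (n_gt0 : (0 < n)%N) (f : 'I_n -> K)
    (f_indep : moore p f != 0)
    (r : nat) (dimV : ASdim pK f r)
    (I J : {set 'I_n})
    (IJ_disjoint : [disjoint I & J]) (IJ_cover : I :|: J = [set: 'I_n])
    (I_basis :
      ASbasis f (fun k : 'I_#|I| => AScls pK (f (enum_val k)))) :
  let A := ASalg pK f in
  let N := (p ^ (n - r))%N in
  let wi : 'I_n -> A := ASvar pK f in
  let w : A := wdet p f wi in
  let d := dcoef p f in
  let Delta := moore p f in
  let Q := Qpoly p f in
  (r <= n)%N /\
  (etale A /\
   exists (L : splittingFieldType K) (j : {rmorphism L -> Kalg}),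
     [/\ forall a : K, j a%:A = iota a,
         galois 1%VS {:L},
         'Gal({:L} / 1%VS) \isog [set: 'rV['F_p]_r],
         exists phi : {lrmorphism A -> {ffun 'I_N -> L}}, bijective phi
       & exists psi : {lrmorphism
             ASalg pK (fun k : 'I_#|I| => f (enum_val k)) -> L},
           bijective psi]) /\
  (exists to : groupAction [set: 'S_N]
                 [set: {dffun forall i : 'I_N, 'rV['F_p]_r}],
     Aut_isog A (sdprod_by to)) /\
  [/\ moore p d != 0,
      forall i : 'I_n,
        wi i = (moore p d)^-1 *:
                 moore p (fun k : 'I_n => if k == i then w else (d k)%:A)
               - (\sum_(k < n.-1) f i ^+ (p ^ k))%:A
        /\ exists q : {poly K}, wi i = horner_alg w q,
      (forall a : A, exists q : {mpoly K[n]}, a = mmap (in_alg A) wi q) /\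
      (forall a : A, exists q : {poly K}, a = horner_alg w q),
      horner_alg w Q = 0 /\
      (exists theta : {lrmorphism {poly %/ Q} -> A},
         bijective theta /\ theta 'qX = w)
    & moore p (minor p f) != 0 /\
      Q = 'X^(p ^ n)
          + \sum_(1 <= i < n)
              ((-1) ^+ (n - i)
               * Delta ^ ((p ^ n.-1)%:Z - (p ^ i.-1)%:Z - (p ^ i)%:Z)
               * moore_omit p (n - i) f ^+ (p ^ i.-1)) *: 'X^(p ^ i)
          + ((-1) ^+ n * Delta ^+ (p ^ n.-1 - 1)) *: 'X
          - (Delta ^+ (p ^ n.-1))%:P].
Proof.
case: n n_gt0 f f_indep dimV I J IJ_disjoint IJ_cover I_basis => // m _ f
  f_indep.
move=> dimV I J IJ_disjoint IJ_cover I_basis A N wi w d Delta Q.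
have p_pr := pcharf_prime pK.
have rE : r = #|I|.
  case: dimV => v bv; apply/eqP; rewrite eqn_leq.
  by rewrite (ASbasis_leq bv I_basis) (ASbasis_leq I_basis bv).
subst r.
have JE : J = ~: I.
  apply/setP=> j; have := congr1 (fun S : {set 'I_m.+1} => j \in S) IJ_cover.
  rewrite !inE; case: (boolP (j \in I)) => jI //= _.
  by rewrite (disjointFr IJ_disjoint jI).
have cJ : (m.+1 - #|I|)%N = #|J|.
  by have := cardsC I; rewrite card_ord JE; lia.
have [L [jL [alpha [jLE alphaAS alpha_gen galL]]]] :=
  splitting_extension pK Kalg_algebraic f_indep.
pose e (k : 'I_#|I|) := enum_val k.
have e_inj : injective e by apply: enum_val_inj.
have fe_free := basis_free I_basis.
have fe_span := basis_span I_basis.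
have e_notinJ k : e k \notin J by rewrite JE inE negbK enum_valP.
have e_cover j : j \notin J -> exists k, e k = j.
  rewrite JE inE negbK => jI; exists (enum_rank_in jI j).
  exact: enum_rankK_in.
have gal_iso := gal_isog pK alphaAS alpha_gen galL fe_free fe_span.
have [b [b_inj b_J b_onto]] := Jpoints_enum pK J.
have NE : N = (p ^ #|J|)%N by rewrite /N cJ.
clearbody N; subst N.
pose phi : {lrmorphism A -> {ffun 'I_(p ^ #|J|) -> L}} := prodmap alphaAS b.
have phi_bij : bijective phi .
  exact: (prodmap_bij pK f_indep alphaAS alpha_gen galL fe_free fe_span
    e_notinJ e_cover b_inj b_J b_onto).
split; first by rewrite -[X in (_ <= X)%N](card_ord m.+1) max_card.
split; [split; first exact: AS_etale|split].
- exists L, jL; split=> //; first by exists phi.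
  exact: (psi_exists pK f_indep alphaAS alpha_gen galL e_inj fe_free fe_span
    e_notinJ e_cover b_J b_onto).
- exists (permute_groupAction 'rV['F_p]_#|I| (p ^ #|J|)).
  case: phi_bij => phi' phiK phi'K.
  rewrite isog_sym in gal_iso.
  have /isogP[sig /injmP sig_inj sig_im] := gal_iso.
  apply: (Aut_product phiK phi'K galL (sigma := sig)) => [u v y|u v|s].
  (* The product of Galois automorphisms applies the left factor first; commutativity of the vector
     group reconciles this with the order required by [Aut_product]. *)
  + rewrite (FinRing.zmod_mulgC u v) morphM ?inE // galM ?memvf //.
  + by apply: sig_inj; rewrite inE.
  + have : s \in 'Gal({:L} / 1%AS)%g.
      rewrite gal_kHom ?sub1v //; apply/kAHomP=> x /vlineP[a ->].
      by rewrite linearZ /= rmorph1.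
    by rewrite -sig_im => /morphimP[v _ _ ->]; exists v.
- split.
  + exact: moore_dcoef_neq0.
  + by move=> i; split; [exact: ASvar_formula|exact: ASvar_horner].
  + by split; [exact: AS_gen|exact: AS_horner].
  + by split; [exact: wdet_root|exact: (theta_exists pK f_indep alphaAS)].
  + by split; [exact: moore_minor_neq0|exact: Qpoly_explicit].
Qed.
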